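(* Let $0<b_1\le b_2$ be constants. There exists a constant $C$ depending only on $b_1$ and $b_2$ such that the following holds. Let $n\ge 3$, $p\ge 2$, $B_n\ge 1$, $a\in\mathbb R^p$, $\alpha\in(0,1)$, and let $X_1,\dots,X_n$ be independent random vectors in $\mathbb R^p$ with $\mathrm E[X_{ij}]=0$ for all $i,j$, such that (Condition E) $\mathrm E[\exp(|X_{ij}|/B_n)]\le 2$ for all $i=1,\dots,n$, $j=1,\dots,p$; (Condition M) $b_1^2\le \frac1n\sum_{i=1}^n \mathrm E[X_{ij}^2]$ and $\frac1n\sum_{i=1}^n\mathrm E[X_{ij}^4]\le B_n^2b_2^2$ for all $j=1,\dots,p$; and (Condition S) for all $i=1,\dots,n$, $X_i$ and $-X_i$ are identically distributed. Suppose that $c^B_{1-\alpha}$ is obtained via the multiplier bootstrap with Rademacher weights. Then $$\left|\mathrm P\left(T_n>c^B_{1-\alpha}\right)-\alpha\right|\le C\left(\frac{B_n^2\log^3(pn)}{n}\right)^{1/2}.$$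
   Context: $X_{ij}$ denotes the $j$th component of $X_i$, and $\bar X_n=n^{-1}\sum_{i=1}^nX_i$. The statistic is $T_n=\max_{1\le j\le p}\frac{1}{\sqrt n}\sum_{i=1}^n (X_{ij}+a_j)$. For the multiplier bootstrap with Rademacher weights, $e_1,\dots,e_n$ are i.i.d. with $\mathrm P(e_i=1)=\mathrm P(e_i=-1)=1/2$, independent of $X_1,\dots,X_n$; $X_i^*=e_i(X_i-\bar X_n)$; and $T_n^*=\max_{1\le j\le p}\frac1{\sqrt n}\sum_{i=1}^n(X_{ij}^*+a_j)$. The critical value $c^B_{1-\alpha}$ is the $(1-\alpha)$th quantile of the conditional distribution of $T_n^*$ given $X_1,\dots,X_n$, where the $\gamma$th quantile of a distribution of $T$ is $\inf\{t\in\mathbb R:\mathrm P(T\le t)\ge\gamma\}$. *)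

(* Defs.v *)
From mathcomp Require Export all_boot all_order all_algebra.
From mathcomp Require Export all_classical all_reals all_analysis.

Set Implicit Arguments.
Unset Strict Implicit.
Unset Printing Implicit Defensive.

Export Order.TTheory GRing.Theory Num.Theory.
Export numFieldNormedType.Exports.

Local Open Scope classical_set_scope.
Local Open Scope ring_scope.

Definition mutually_independent d (T : measurableType d) (R : realType)
    (P : probability T R) d' (U : measurableType d') (I : finType)
    (X : I -> T -> U) : Prop :=
  forall (J : {set I}) (A : I -> set U), (forall i, measurable (A i)) ->
    P (\bigcap_(i in [set` J]) X i @^-1` A i) =
    (\prod_(i in J) P (X i @^-1` A i))%E.

Definition independent2 d (T : measurableType d) (R : realType)
    (P : probability T R) d1 (U : measurableType d1) d2 (V : measurableType d2)
    (Y : T -> U) (Z : T -> V) : Prop :=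
  forall (A : set U) (B : set V), measurable A -> measurable B ->
    P (Y @^-1` A `&` Z @^-1` B) = (P (Y @^-1` A) * P (Z @^-1` B))%E.

Definition identically_distributed d (T : measurableType d) (R : realType)
    (P : probability T R) d' (U : measurableType d') (Y Z : T -> U) : Prop :=
  forall A : set U, measurable A -> P (Y @^-1` A) = P (Z @^-1` A).

(* [k] is a regular version of the conditional distribution of [Y] given [Z]:
   [k z] is the law of [Y] given [Z = z]. *)
Definition conditional_distribution d (T : measurableType d) (R : realType)
    (P : probability T R) d1 (U : measurableType d1) d2 (V : measurableType d2)
    (Y : T -> V) (Z : T -> U) (k : R.-pker U ~> V) : Prop :=
  forall (A : set U) (B : set V), measurable A -> measurable B ->
    P (Z @^-1` A `&` Y @^-1` B) = (\int[P]_(w in Z @^-1` A) k (Z w) B)%E.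

Definition quantile (R : realType) (mu : set R -> \bar R) (gamma : R) : R :=
  inf [set t | (gamma%:E <= mu `]-oo, t]%classic)%E].

Definition rademacher d (T : measurableType d) (R : realType)
    (P : probability T R) (e : T -> R) : Prop :=
  P [set w | e w = 1] = (2^-1)%:E /\ P [set w | e w = -1] = (2^-1)%:E.

(* The default value of the iterated maximum is the first entry, so that the
   result is the maximum of the [f j] whenever [0 < p]. *)
Definition max_coord (R : realType) (p : nat) (f : 'I_p -> R) : R :=
  \big[Num.max/head 0 [seq f j | j : 'I_p]]_(j < p) f j.

Lemma max_coord_max (R : realType) (p : nat) (f : 'I_p -> R) : (0 < p)%N ->
  (exists j, max_coord f = f j) /\ (forall j, f j <= max_coord f).
Proof.
case: p f => // p f _; split; last by move=> j; exact: le_bigmax.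
have hd0 : head 0 [seq f j | j : 'I_p.+1] = f ord0.
  by rewrite /image_mem enum_ordSl.
exists [arg max_(i > ord0) f i]%O; apply/eqP.
rewrite eq_le le_bigmax andbT; apply/bigmax_leP; split=> [|i _].
  by rewrite hd0; case: arg_maxP => //= k _; apply.
by case: arg_maxP => //= k _; apply.
Qed.

Section statistic.
Context (R : realType) (n p : nat).

(* A sample [x] lists the [n] observations, each a vector of [R^p]; as a
   [measurableType], [p.-tuple R] carries the Borel sigma-algebra of [R^p]. *)
Notation sample := (n.-tuple (p.-tuple R)).

Definition sample_mean (x : sample) (j : 'I_p) : R :=
  n%:R^-1 * \sum_(i < n) tnth (tnth x i) j.

Definition max_stat (a : p.-tuple R) (x : sample) : R :=
  max_coord (fun j : 'I_p =>
    (Num.sqrt n%:R)^-1 * \sum_(i < n) (tnth (tnth x i) j + tnth a j)).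

Definition multiplier_sample (e : n.-tuple R) (x : sample) : sample :=
  [tuple [tuple tnth e i * (tnth (tnth x i) j - sample_mean x j) | j < p]
    | i < n].

End statistic.

Definition oppt (R : realType) (p : nat) (x : p.-tuple R) : p.-tuple R :=
  [tuple - tnth x j | j < p].

Definition joint (T U : Type) (n : nat) (X : 'I_n -> T -> U) (w : T) :
  n.-tuple U := [tuple X i w | i < n].

(* Main.v *)
From HB Require Import structures.
Require Import Defs.
From mathcomp Require Import measurable_realfun ring lra.

Set Implicit Arguments.
Unset Strict Implicit.
Unset Printing Implicit Defensive.

Local Open Scope classical_set_scope.
Local Open Scope ring_scope.

(** The sample is symmetric, so its law is unchanged when each observation is
multiplied by its own sign.  Given the orbit of the sample under the [2 ^ n]
sign changes, the statistic is therefore a uniformly chosen one among the [2 ^ n]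
values [max_stat a (sign_flip c x)].  A critical value equal to a quantile of
these values would give an exact randomization test, up to ties.  The bootstrap
statistic [boot_stat a c x] is such a value with each observation centred at
the sample mean; centring moves it by at most the product of the normalized sum
of the signs and of the largest coordinate of the sample mean, which is of order
[B * L / sqrt n] with [L = ln (p * n)], outside an event of negligible
probability.  Hence the error is controlled by the fraction of the [2 ^ n] values
that lie in a window of that width ([randomization_error]).

That fraction is bounded by an anti-concentration inequality for the maximum of
[p] affine forms in Rademacher signs ([max_anti_concentration]), whose proof is
an integration by parts on the cube.  Let [M] be the maximum, [J] the index
attaining it, and [g] a ramp climbing from 0 to 1 just above the lower end of the
window.  The mean of [g (M) * (w_J . e)] is at most the mean of the largest
linear form, of order [sigma * sqrt (ln p)].  Pairing each vertex with its
neighbours writes the same mean as a sum over edges; since [M] is convex, every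
edge contributes nonnegatively, and an edge along which [M] moves up from the
window contributes the slope of [g] times a squared coefficient
([le_cube_mean_argmax]).  Summing the squared coefficients of the rows gives back
[sigma ^ 2] times the fraction of vertices in the window.  Rows of different
norms are treated by dyadic groups, whose contributions form a geometric series.
For a window of width [B * L / sqrt n] this yields the rate
[B * L / sqrt n * sqrt L].

The entries of the data must be bounded by a multiple of [B * L], every
coordinate must keep a second moment of the right order, and the sample mean must
be small.  These events are handled by Chernoff bounds
([irregular_probability]).  Finally, the given kernel agrees almost surely with
the law of the bootstrap statistic under uniform signs, and since only rational
thresholds matter for the event that the statistic exceeds its critical value,
that event is, up to a null set, one about the sample alone
([probability_quantile_lt]). *)

(** * Exponential inequalities *)

Section ExpBounds.
Context {R : realType}.
Implicit Types x c : R.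

Lemma expR_le_quad x : x <= 2^-1 -> expR x <= 1 + x + 2 * x ^+ 2.
Proof.
move=> hx; have h1 : 1 - x <= expR (- x) by rewrite expR_ge1Dx.
have h2 : 0 < 1 - x by lra.
have h3 : expR x <= (1 - x)^-1.
  by rewrite -[x in expR x]opprK expRN lef_pV2// posrE expR_gt0.
apply: (le_trans h3); rewrite -div1r ler_pdivrMr//.
have h4 : 0 <= x ^+ 2 * (1 - 2 * x) by rewrite mulr_ge0 ?sqr_ge0//; lra.
by nra.
Qed.

(** The factor [expR `|x|] pays for the range beyond the quadratic bound above;
it is what an exponential moment condition can absorb. *)
Lemma expR_le_quad_expR x : expR x <= 1 + x + 4 * x ^+ 2 * expR `|x|.
Proof.
have e1 : 1 <= expR `|x| by rewrite -expR0 ler_expR.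
have x2 := sqr_ge0 x.
have [hx|hx] := leP x 2^-1.
  by apply: (le_trans (expR_le_quad hx)); nra.
rewrite gtr0_norm; last by lra.
have := expR_gt0 x => ?.
have : 1 <= 4 * x ^+ 2 by nra.
by nra.
Qed.

(** For small [c] the linear terms of the two quadratic bounds cancel; for
[c > 1/2] both exponentials are at most [expR c], and [c <= 2 * c ^+ 2]. *)
Lemma cosh_le_expR c : (expR c + expR (- c)) / 2 <= expR (2 * c ^+ 2).
Proof.
have h2 := expR_ge1Dx (2 * c ^+ 2).
wlog hc : c h2 / 0 <= c.
  move=> W; have [|hc] := leP 0 c; first exact: W.
  have := W (- c); rewrite sqrrN opprK => /(_ h2) W'; rewrite addrC.
  by apply: W'; lra.
have [hx|hx] := leP c 2^-1.
  have := expR_le_quad hx.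
  have : - c <= 2^-1 by lra.
  move/expR_le_quad; rewrite sqrrN; lra.
have : expR c <= expR (2 * c ^+ 2) by rewrite ler_expR; nra.
have : expR (- c) <= expR c by rewrite ler_expR; lra.
lra.
Qed.

End ExpBounds.

(** * Rademacher sums on the discrete cube *)

Section Cube.
Context {R : realType} {n : nat}.
Notation cube := {ffun 'I_n -> bool}.
Implicit Types (e : cube) (f g : cube -> R) (i : 'I_n).

Definition sgn e i : R := (-1) ^+ e i.

Definition cube_mean f : R := (2 ^+ n)^-1 * \sum_e f e.

Definition cube_prob (A : pred cube) : R := cube_mean (fun e => (A e)%:R).

Lemma sgn_sqr e i : sgn e i * sgn e i = 1.
Proof. by rewrite /sgn; case: (e i); rewrite ?expr0 ?expr1 ?mulr1 ?mulrNN ?mulr1. Qed.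

Lemma normr_sgn e i : `|sgn e i| = 1.
Proof. by rewrite /sgn normrX normrN1 expr1n. Qed.

Lemma le_cube_mean f g : (forall e, f e <= g e) -> cube_mean f <= cube_mean g.
Proof. by move=> fg; rewrite ler_wpM2l ?invr_ge0 ?exprn_ge0// ler_sum. Qed.

Lemma cube_mean_ge0 f : (forall e, 0 <= f e) -> 0 <= cube_mean f.
Proof. by move=> fg; rewrite mulr_ge0 ?invr_ge0 ?exprn_ge0// sumr_ge0. Qed.

Lemma cube_meanD f g : cube_mean (fun e => f e + g e) = cube_mean f + cube_mean g.
Proof. by rewrite /cube_mean big_split mulrDr. Qed.

Lemma cube_meanZ (c : R) f : cube_mean (fun e => c * f e) = c * cube_mean f.
Proof. by rewrite /cube_mean -mulr_sumr mulrCA. Qed.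

Lemma cube_mean_cst (c : R) : cube_mean (fun=> c) = c.
Proof.
rewrite /cube_mean sumr_const card_ffun card_bool card_ord -[c *+ _]mulr_natr.
by rewrite natrX mulrCA mulVf ?mulr1// expf_neq0.
Qed.

Lemma cube_mean_sum (I : Type) (r : seq I) (F : I -> cube -> R) :
  cube_mean (fun e => \sum_(j <- r) F j e) = \sum_(j <- r) cube_mean (F j).
Proof. by rewrite /cube_mean exchange_big mulr_sumr. Qed.

Lemma le_cube_prob (A B : pred cube) : (forall e, A e -> B e) ->
  cube_prob A <= cube_prob B.
Proof.
move=> AB; apply: le_cube_mean => e.
by rewrite ler_nat; case: (boolP (A e)) => // /AB ->.
Qed.

Lemma cube_prob_le1 (A : pred cube) : cube_prob A <= 1.
Proof. by rewrite -[leRHS]cube_mean_cst le_cube_mean// => e; case: (A e). Qed.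

Lemma cube_prob_ge0 (A : pred cube) : 0 <= cube_prob A.
Proof. exact: cube_mean_ge0. Qed.

Lemma cube_probU (A B : pred cube) :
  cube_prob [pred e | A e || B e] <= cube_prob A + cube_prob B.
Proof.
rewrite -cube_meanD; apply: le_cube_mean => e /=.
by case: (A e) (B e) => -[]//=; rewrite ?addr0 ?add0r// ler_wpDl.
Qed.

Lemma cube_probC (A : pred cube) : cube_prob (predC A) = 1 - cube_prob A.
Proof.
apply/eqP; rewrite eq_sym subr_eq -cube_meanD -[X in X == _]cube_mean_cst.
by apply/eqP; congr cube_mean; apply/funext => e /=; case: (A e); rewrite ?addr0 ?add0r.
Qed.

Lemma cube_prob_exists (I : finType) (A : I -> pred cube) (B : pred cube) :
  (forall e, B e -> exists j, A j e) -> cube_prob B <= \sum_j cube_prob (A j).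
Proof.
move=> BA; rewrite -cube_mean_sum; apply: le_cube_mean => e.
case: (boolP (B e)) => [/BA[j Aj]|_]; last exact: sumr_ge0.
by rewrite (bigD1 j)//= Aj lerDl sumr_ge0.
Qed.

Lemma cube_prob_le_mean (A : pred cube) f : (forall e, 0 <= f e) ->
  (forall e, A e -> 1 <= f e) -> cube_prob A <= cube_mean f.
Proof.
move=> f0 Af; apply: le_cube_mean => e.
by case: (boolP (A e)) => [/Af|].
Qed.

Lemma cube_mean_prod (F : 'I_n -> bool -> R) :
  cube_mean (fun e => \prod_i F i (e i)) = \prod_i ((F i true + F i false) / 2).
Proof.
rewrite /cube_mean -(bigA_distr_bigA (fun i b => F i b)) big_split/= mulrC.
congr (_ * _); last by rewrite prodr_const card_ord exprVn.
by apply: eq_bigr => i _; rewrite big_bool.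
Qed.

(** The mean of a product of functions of distinct coordinates factors, and each
factor is here a hyperbolic cosine. *)
Lemma cube_mean_expR (c : 'I_n -> R) :
  cube_mean (fun e => expR (\sum_i c i * sgn e i)) <= expR (2 * \sum_i c i ^+ 2).
Proof.
pose F i (b : bool) : R := expR (c i * (-1) ^+ b).
have -> : (fun e => expR (\sum_i c i * sgn e i)) = (fun e => \prod_i F i (e i)).
  by apply/funext => e; rewrite expR_sum.
rewrite cube_mean_prod mulr_sumr expR_sum ler_prod// => i _.
rewrite /F expr0 expr1 mulr1 mulrN1 addrC cosh_le_expR andbT.
by rewrite divr_ge0// addr_ge0// expR_ge0.
Qed.

(** Hoeffding's inequality: [l = s / (4 * V)] minimizes [2 * l ^+ 2 * V - l * s]. *)
Lemma cube_prob_sum_gt (c : 'I_n -> R) (V s : R) : 0 <= s -> 0 < V ->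
  \sum_i c i ^+ 2 <= V ->
  cube_prob [pred e | s < \sum_i c i * sgn e i] <= expR (- (s ^+ 2 / (8 * V))).
Proof.
move=> s0 V0 cV; pose l := s / (4 * V).
have l0 : 0 <= l by rewrite divr_ge0// mulr_ge0// ltW.
apply: (@le_trans _ _ (cube_mean (fun e => expR (- (l * s)) *
    expR (\sum_i (l * c i) * sgn e i)))).
  apply: cube_prob_le_mean => [e|e /= hs]; first by rewrite mulr_ge0// expR_ge0.
  rewrite -expRD -expR0 ler_expR.
  under eq_bigr do rewrite -mulrA.
  rewrite -mulr_sumr addrC -mulrBr mulr_ge0// subr_ge0 ltW//.
rewrite cube_meanZ.
apply: (le_trans (ler_wpM2l (expR_ge0 _) (cube_mean_expR _))).
rewrite -expRD ler_expR.
under eq_bigr do rewrite exprMn.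
rewrite -mulr_sumr.
have : l ^+ 2 * \sum_i c i ^+ 2 <= l ^+ 2 * V by rewrite ler_wpM2l// sqr_ge0.
have -> : l ^+ 2 * V = s ^+ 2 / (16 * V) by rewrite /l; field; rewrite gt_eqF.
have -> : l * s = s ^+ 2 / (4 * V) by rewrite /l; field; rewrite gt_eqF.
have -> : s ^+ 2 / (8 * V) = 2 * (s ^+ 2 / (16 * V)) by field; rewrite gt_eqF.
have -> : s ^+ 2 / (4 * V) = 4 * (s ^+ 2 / (16 * V)) by field; rewrite gt_eqF.
lra.
Qed.

(** Maximal inequality.  The selection rule [J] is arbitrary, so this bounds the
mean of the largest of the linear forms.  The inequality
[z <= u + l^-1 * expR (l * (z - u))] replaces the largest form by the sum of the
exponentials of all of them; the threshold [u] is chosen so that the union over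
[I] costs one term [l^-1]. *)
Lemma cube_mean_abs_sum (I : finType) (c : I -> 'I_n -> R) (J : cube -> I)
    (tau L : R) : 0 < tau -> 1 <= L -> 2 * #|I|%:R <= expR L ->
  (forall e, \sum_i c (J e) i ^+ 2 <= tau ^+ 2) ->
  cube_mean (fun e => `|\sum_i c (J e) i * sgn e i|) <= 4 * tau * Num.sqrt L.
Proof.
move=> tau0 L1 IL cV; pose rL := Num.sqrt L.
have L0 : 0 <= L by lra.
have rLL : rL ^+ 2 = L by rewrite sqr_sqrtr.
have rL1 : 1 <= rL by rewrite -sqrtr1 ler_wsqrtr.
pose l := rL / tau; pose u := 3 * tau * rL.
have l0 : 0 < l by rewrite divr_gt0//; lra.
pose S j e := \sum_i c j i * sgn e i.
(* Only selected indices are known to satisfy the norm bound; the coefficients of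
     the others are set to 0 to make the moment bound uniform. *)
pose c' j i : R := if \sum_i c j i ^+ 2 <= tau ^+ 2 then c j i else 0.
pose S' j e := \sum_i c' j i * sgn e i.
have SS e : S (J e) e = S' (J e) e.
  by apply: eq_bigr => i _; rewrite /c' cV.
have c'V j : \sum_i c' j i ^+ 2 <= tau ^+ 2.
  have [h|h] := boolP (\sum_i c j i ^+ 2 <= tau ^+ 2).
    by rewrite (eq_bigr (fun i => c j i ^+ 2))// => i _; rewrite /c' h.
  by rewrite big1 ?sqr_ge0// => i _; rewrite /c' (negbTE h) expr0n.
have mgf (t : R) j : t ^+ 2 = l ^+ 2 ->
    cube_mean (fun e => expR (t * S' j e)) <= expR (2 * L).
  move=> tl.
  have -> : (fun e => expR (t * S' j e)) =
      (fun e => expR (\sum_i (t * c' j i) * sgn e i)).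
    by apply/funext => e; rewrite /S' mulr_sumr; under eq_bigr do rewrite mulrA.
  apply: (le_trans (cube_mean_expR _)); rewrite ler_expR ler_wpM2l//.
  under eq_bigr do rewrite exprMn.
  rewrite -mulr_sumr tl -rLL.
  have -> : rL ^+ 2 = l ^+ 2 * tau ^+ 2 by rewrite /l; field; rewrite gt_eqF.
  by rewrite ler_wpM2l// sqr_ge0.
have lu : l * u = 3 * L by rewrite /l /u -rLL; field; rewrite gt_eqF.
apply: (@le_trans _ _ (cube_mean (fun e => u + l^-1 * expR (- (3 * L)) *
   \sum_j (expR (l * S' j e) + expR (- l * S' j e))))).
  apply: le_cube_mean => e; rewrite -/(S (J e) e) SS.
  set x := S' (J e) e.
  have h1 : expR (l * `|x|) <= \sum_j (expR (l * S' j e) + expR (- l * S' j e)).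
    rewrite (bigD1 (J e))//= -/x.
    have h0 : 0 <= \sum_(j | j != J e) (expR (l * S' j e) + expR (- l * S' j e)).
      by apply: sumr_ge0 => j _; rewrite addr_ge0// expR_ge0.
    have := expR_ge0 (l * x); have := expR_ge0 (- l * x).
    by case: (ger0P x) => _; rewrite ?mulrN ?mulNr; lra.
  have h2 := expR_ge1Dx (l * (`|x| - u)).
  have h3 : expR (l * (`|x| - u)) <= expR (- (3 * L)) *
      \sum_j (expR (l * S' j e) + expR (- l * S' j e)).
    by rewrite mulrBr lu addrC expRD ler_wpM2l// expR_ge0.
  rewrite -mulrA -lerBlDl ler_pdivlMl//; lra.
rewrite cube_meanD cube_mean_cst cube_meanZ cube_mean_sum.
have h4 : \sum_j cube_mean (fun e => expR (l * S' j e) + expR (- l * S' j e)) <=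
    expR (3 * L).
  apply: (@le_trans _ _ (\sum_(j : I) 2 * expR (2 * L))).
    apply: ler_sum => j _; rewrite cube_meanD.
    have := mgf l j erefl; have := mgf (- l) j (sqrrN _); lra.
  rewrite sumr_const -[(_ * _) *+ _]mulr_natl mulrA [_ * 2]mulrC.
  have -> : 3 * L = L + 2 * L by lra.
  by rewrite expRD ler_wpM2r// expR_ge0.
apply: (@le_trans _ _ (u + l^-1)).
  have l10 : 0 <= l^-1 by rewrite invr_ge0 ltW.
  rewrite lerD2l -mulrA ler_piMr//.
  by rewrite expRN ler_pdivrMl ?expR_gt0// mulr1.
have -> : l^-1 = tau / rL by rewrite /l invf_div.
rewrite /u -/rL.
have : tau / rL <= tau * rL.
  by rewrite ler_pM2l// (le_trans _ rL1)// invf_le1//; lra.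
lra.
Qed.

Definition flip i e : cube := [ffun k => if k == i then ~~ e k else e k].

Lemma flipK i : involutive (flip i).
Proof. by move=> e; apply/ffunP => k; rewrite !ffunE; case: eqP => // _; rewrite negbK. Qed.

Lemma sgn_flip i e k : sgn (flip i e) k = if k == i then - sgn e k else sgn e k.
Proof.
by rewrite /sgn ffunE; case: eqP => // _; case: (e k); rewrite ?expr0 ?expr1 ?opprK.
Qed.

Lemma cube_mean_flip i f : cube_mean (f \o flip i) = cube_mean f.
Proof.
by rewrite /cube_mean [in RHS](reindex_inj (can_inj (flipK i))).
Qed.

End Cube.
Arguments sgn {R n}.

(** * Anti-concentration of the maximum of affine forms in random signs *)

Section AntiConcentration.
Context {R : realType} {n : nat} {I : finType}.
Notation cube := {ffun 'I_n -> bool}.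
Implicit Types (e : cube).
Variables (w : I -> 'I_n -> R) (b : I -> R).

Definition affine_form j e : R := b j + \sum_i w j i * sgn e i.

Lemma affine_form_flip j i e :
  affine_form j (flip i e) = affine_form j e - 2 * (w j i * sgn e i).
Proof.
rewrite /affine_form (bigD1 i)//= [in RHS](bigD1 i)//= sgn_flip eqxx.
under eq_bigr => k ki do rewrite sgn_flip (negbTE ki).
ring.
Qed.

(** One edge of the cube in direction [i].  The numbers [m] and [m'] stand for the
maximum at its two ends, and [u], [v] for the products of the [i]-th coefficient of
the maximizing form at either end with the sign at the first end.  The two linear
hypotheses say that each maximum dominates the other end's maximizing form; added
together they give [v <= u], which is convexity.  At most one of the two terms on
the left is nonzero: the one of an end from which the maximum increases. *)
Lemma flip_increment (g : R -> R) (m m' u v : R) :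
  {homo g : x y / x <= y} -> (forall x, 0 <= g x) ->
  m - 2 * u <= m' -> m' + 2 * v <= m ->
  (u < 0)%R%:R * (`|u| * (g (m + 2 * `|u|) - g m)) +
  (0 < v)%R%:R * (`|v| * (g (m' + 2 * `|v|) - g m')) <= g m * u - g m' * v.
Proof.
move=> gm g0 h1 h2; have uv : v <= u by lra.
have gm0 := g0 m; have gm'0 := g0 m'.
have [hu|hu] := ltP u 0.
  have vn : v < 0 by lra.
  rewrite ltNge (ltW vn)/= mul0r addr0 mul1r ltr0_norm//.
  have : g (m + 2 * - u) <= g m' by apply: gm; lra.
  nra.
rewrite mul0r add0r; have [hv|hv] := ltP 0 v; last by rewrite mul0r; nra.
rewrite mul1r gtr0_norm//.
have : g (m' + 2 * v) <= g m by apply: gm; lra.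
nra.
Qed.

(** Discrete integration by parts for the vector field [g (M) * w_J], where
[w_J] is the gradient of the convex function [M].  Changes of the maximizing index
across an edge can only increase the right-hand side, so that no term for them
appears on the left. *)
Lemma le_cube_mean_argmax (G : pred I) (J : cube -> I) (g : R -> R) :
  {homo g : x y / x <= y} -> (forall x, 0 <= g x) ->
  (forall e, G (J e)) ->
  (forall e j, G j -> affine_form j e <= affine_form (J e) e) ->
  cube_mean (fun e => \sum_i (w (J e) i * sgn e i < 0)%R%:R *
    (`|w (J e) i| * (g (affine_form (J e) e + 2 * `|w (J e) i|) -
                     g (affine_form (J e) e)))) <=
  cube_mean (fun e => g (affine_form (J e) e) * \sum_i w (J e) i * sgn e i).
Proof.
move=> gm g0 GJ maxJ.
have -> : (fun e => g (affine_form (J e) e) * \sum_i w (J e) i * sgn e i) =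
  (fun e => \sum_i g (affine_form (J e) e) * (w (J e) i * sgn e i)).
  by apply/funext => e; rewrite mulr_sumr.
rewrite !cube_mean_sum; apply: ler_sum => i _.
set lhs := (X in cube_mean X <= _); set rhs := (X in _ <= cube_mean X).
suff : cube_mean lhs + cube_mean (lhs \o flip i) <=
       cube_mean rhs + cube_mean (rhs \o flip i) by rewrite !cube_mean_flip; lra.
rewrite -!cube_meanD; apply: le_cube_mean => e /=; rewrite /lhs /rhs.
set e' := flip i e; set m := affine_form (J e) e; set m' := affine_form (J e') e'.
pose u := w (J e) i * sgn e i; pose v := w (J e') i * sgn e i.
have h1 : m - 2 * u <= m' by rewrite /m /u -affine_form_flip; exact: maxJ.
have h2 : m' + 2 * v <= m.
  have -> : m' = affine_form (J e') e - 2 * v by rewrite /m' affine_form_flip.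
  by rewrite subrK; exact: maxJ.
have := flip_increment gm g0 h1 h2.
have -> : `|u| = `|w (J e) i| by rewrite normrM normr_sgn mulr1.
have -> : `|v| = `|w (J e') i| by rewrite normrM normr_sgn mulr1.
by rewrite -/u sgn_flip eqxx mulrN -/v oppr_lt0 mulrN.
Qed.

(** The bound for rows of comparable norm.  The last conjunct of the event keeps
at least a quarter of [\sum_i w j i ^+ 2] on the coordinates where the sign
opposes the coefficient, which are the ones that count on the left of
[le_cube_mean_argmax]. *)
Lemma max_anti_concentration_group (G : pred I) (J : cube -> I)
    (om s tau L t d : R) :
  (forall e, G (J e)) ->
  (forall e j, G j -> affine_form j e <= affine_form (J e) e) ->
  0 <= d -> 0 < om -> (forall j i, `|w j i| <= om) ->
  0 < tau -> 1 <= L -> 2 * #|I|%:R <= expR L ->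
  (forall j, G j -> s ^+ 2 <= \sum_i w j i ^+ 2 <= tau ^+ 2) ->
  cube_prob [pred e | (t <= affine_form (J e) e <= t + d) &&
    [forall j, \sum_i (w j i * `|w j i|) * sgn e i <= (\sum_i w j i ^+ 2) / 2]] *
    s ^+ 2 <= 8 * (d + 2 * om) * tau * Num.sqrt L.
Proof.
move=> GJ maxJ d0 om0 wom tau0 L1 IL Gw.
(* The increments of [g] are taken over lengths up to [2 * om], so the ramp
   extends that far above the window. *)
pose D := d + 2 * om; have D0 : 0 < D by rewrite /D; lra.
pose g x : R := Num.min 1 (Num.max 0 ((x - t) / D)).
have gm : {homo g : x y / x <= y}.
  move=> x y xy; rewrite /g le_min ge_min lexx/=.
  rewrite ge_min; apply/orP; right; rewrite ge_max le_max lexx/= le_max.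
  by apply/orP; right; rewrite ler_pM2r ?invr_gt0//; lra.
have g0 x : 0 <= g x by rewrite /g le_min ler01 le_max lexx.
have g1 x : g x <= 1 by rewrite /g ge_min lexx.
have gE x : t <= x -> x <= t + D -> g x = (x - t) / D.
  move=> x1 x2; have h0 : 0 <= (x - t) / D by rewrite divr_ge0 ?subr_ge0// ltW.
  rewrite /g max_r// min_r//.
  by rewrite ler_pdivrMr//; lra.
have := le_cube_mean_argmax gm g0 GJ maxJ.
set lhs := (X in cube_mean X <= _); set rhs := (X in _ <= cube_mean X).
move=> main.
have hr : cube_mean rhs <= 4 * tau * Num.sqrt L.
  have hJ e : \sum_i w (J e) i ^+ 2 <= tau ^+ 2 by case/andP: (Gw _ (GJ e)).
  refine (le_trans _ (cube_mean_abs_sum tau0 L1 IL hJ)).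
  apply: le_cube_mean => e; rewrite /rhs.
  apply: (le_trans (ler_norm _)); rewrite normrM ger0_norm//.
  by rewrite ler_piMl.
have hl e : t <= affine_form (J e) e <= t + d ->
    lhs e = D^-1 * (\sum_i w (J e) i ^+ 2 -
                    \sum_i (w (J e) i * `|w (J e) i|) * sgn e i).
  move=> /andP[t1 t2]; rewrite /lhs -sumrB mulr_sumr; apply: eq_bigr => i _.
  have wi := wom (J e) i; have wi0 := normr_ge0 (w (J e) i).
  rewrite !gE; [|rewrite /D; lra..].
  have w2 : w (J e) i ^+ 2 = `|w (J e) i| ^+ 2 by rewrite real_normK// num_real.
  rewrite w2 mulrAC; set ws := w (J e) i * sgn e i.
  have aws : `|ws| = `|w (J e) i| by rewrite normrM normr_sgn mulr1.
  rewrite -aws; case: ltrP => h.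
    by rewrite ltr0_norm//= mul1r; field; rewrite gt_eqF.
  by rewrite ger0_norm//= mul0r; field; rewrite gt_eqF.
rewrite mulrC -/D; set pr := cube_prob _.
suff h : s ^+ 2 * (2 * D)^-1 * pr <= cube_mean lhs.
  have : (2 * D) * (s ^+ 2 * (2 * D)^-1 * pr) <= (2 * D) * (4 * tau * Num.sqrt L).
    by rewrite ler_wpM2l//; lra.
  have -> : (2 * D) * (s ^+ 2 * (2 * D)^-1 * pr) = s ^+ 2 * pr.
    by field; rewrite gt_eqF.
  lra.
rewrite -cube_meanZ; apply: le_cube_mean => e /=.
have lhs0 : 0 <= lhs e.
  apply: sumr_ge0 => i _; rewrite mulr_ge0// mulr_ge0// subr_ge0 gm//.
  by rewrite lerDl mulr_ge0.
case: (boolP (_ && _)); last by rewrite mulr0.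
move=> /andP[hI /forallP hQ]; rewrite mulr1 hl//.
case/andP: (Gw _ (GJ e)) => s1 _; move: (hQ (J e)) => q1.
have D10 : 0 <= D^-1 by rewrite invr_ge0 ltW.
rewrite invfM mulrA [leRHS]mulrC ler_wpM2r//; lra.
Qed.

End AntiConcentration.

Section AntiConcentrationMax.
Context {R : realType} {n : nat} {I : finType}.
Notation cube := {ffun 'I_n -> bool}.
Implicit Types (e : cube).
Variables (w : I -> 'I_n -> R) (b : I -> R).
Notation affine_form := (affine_form w b).

Lemma sum_geometric_half (K : nat) : \sum_(k < K) (2^-1 : R) ^+ k <= 2.
Proof.
suff -> : \sum_(k < K) (2^-1 : R) ^+ k = 2 - 2 * 2^-1 ^+ K.
  by rewrite gerBl mulr_ge0// exprn_ge0// invr_ge0.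
elim: K => [|K IH]; first by rewrite big_ord0 expr0; lra.
by rewrite big_ord_recr/= IH exprS; lra.
Qed.

(** Each row falls into one dyadic group. *)
Lemma dyadic_bracket (s V : R) : 0 < s -> s ^+ 2 <= V ->
  exists k : nat, (s * 2 ^+ k) ^+ 2 <= V <= (s * 2 ^+ k.+1) ^+ 2.
Proof.
move=> s0 sV; have V0 : 0 <= V by rewrite (le_trans _ sV)// sqr_ge0.
have ex : exists k : nat, V <= (s * 2 ^+ k.+1) ^+ 2.
  pose m := Num.trunc (V / s ^+ 2); exists m.
  have h1 : V / s ^+ 2 <= m.+1%:R by rewrite ltW// truncnS_gt.
  have h2 : (m.+1%:R : R) <= 2 ^+ m.+1 by rewrite -natrX ler_nat ltnW// ltn_expl.
  have h3 : (2 : R) ^+ m.+1 <= (2 ^+ m.+1) ^+ 2.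
    by rewrite expr2 ler_peMl ?exprn_ge0// exprn_ege1// ler1n.
  rewrite exprMn mulrC -ler_pdivrMr ?exprn_gt0//.
  by rewrite (le_trans h1)// (le_trans h2).
case: (ex_minnP ex) => k hk kmin; exists k; rewrite hk andbT.
case: k hk kmin => [|k] hk kmin; first by rewrite expr0 mulr1.
by rewrite leNgt; apply/negP => /ltW /kmin; rewrite ltnn.
Qed.

Definition balanced e := [forall j,
  \sum_i (w j i * `|w j i|) * sgn e i <= (\sum_i w j i ^+ 2) / 2].

(** The sum of the [w j i * `|w j i|] with random signs has variance at most
[om ^+ 2 * \sum_i w j i ^+ 2], which is small compared with the square of
[\sum_i w j i ^+ 2] when no single coefficient dominates. *)
Lemma cube_prob_unbalanced (om s : R) : 0 < om -> 0 < s ->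
  (forall j i, `|w j i| <= om) -> (forall j, s ^+ 2 <= \sum_i w j i ^+ 2) ->
  cube_prob (predC balanced) <= #|I|%:R * expR (- (s ^+ 2 / (32 * om ^+ 2))).
Proof.
move=> om0 s0 wom sw; rewrite -sum1_card natr_sum mulr_suml.
pose A j : pred cube := [pred e | (\sum_i w j i ^+ 2) / 2 <
  \sum_i (w j i * `|w j i|) * sgn e i].
apply: (le_trans (cube_prob_exists (A := A) _)) => [e /=|].
  by rewrite negb_forall => /existsP[j]; rewrite -ltNge; exists j.
apply: ler_sum => j _; rewrite mul1r; set V := \sum_i w j i ^+ 2.
have V0 : 0 < V by rewrite (lt_le_trans _ (sw j))// exprn_gt0.
have V20 : 0 <= V / 2 by rewrite divr_ge0// ltW.
have oV : 0 < om ^+ 2 * V by rewrite mulr_gt0// exprn_gt0.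
apply: (le_trans (cube_prob_sum_gt V20 oV _)).
  rewrite /V mulr_sumr; apply: ler_sum => i _.
  rewrite exprMn mulrC ler_wpM2r ?sqr_ge0//.
  by rewrite lerXn2r// nnegrE ?ltW.
rewrite ler_expR lerN2.
have -> : (V / 2) ^+ 2 / (8 * (om ^+ 2 * V)) = V / (32 * om ^+ 2).
  by field; rewrite !gt_eqF.
by rewrite ler_wpM2r ?sw// invr_ge0 mulr_ge0// sqr_ge0.
Qed.

Variables (om s L d : R).
Hypotheses (om0 : 0 < om) (s0 : 0 < s) (d0 : 0 <= d).
Hypotheses (wom : forall j i, `|w j i| <= om).
Hypotheses (L1 : 1 <= L) (IL : 2 * #|I|%:R <= expR L).

(** The event is written with an explicit maximizing index in [G], so that it
makes sense, and is empty, for an empty group. *)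
Lemma anti_concentration_dyadic (k : nat) (t : R) (G : pred I) :
  (forall j, G j -> (s * 2 ^+ k) ^+ 2 <= \sum_i w j i ^+ 2 <= (s * 2 ^+ k.+1) ^+ 2) ->
  cube_prob [pred e | [exists j, [&& G j, t <= affine_form j e <= t + d &
      [forall j', G j' ==> (affine_form j' e <= affine_form j e)]]] && balanced e] <=
    16 * (d + 2 * om) / s * Num.sqrt L * 2^-1 ^+ k.
Proof.
move=> Gk; set A := (X in cube_prob X <= _).
have k0 : (0 : R) < 2 ^+ k by rewrite exprn_gt0.
have rhs0 : 0 <= 16 * (d + 2 * om) / s * Num.sqrt L * 2^-1 ^+ k.
  rewrite mulr_ge0 ?exprn_ge0 ?invr_ge0// mulr_ge0 ?sqrtr_ge0// mulr_ge0//.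
    by have := om0; have := d0; lra.
  by rewrite invr_ge0 ltW.
have [j0 Gj0|G0] := pickP G; last first.
  rewrite (le_trans (le_cube_prob (B := pred0) _))//; last first.
    by rewrite /cube_prob cube_mean_cst.
  by move=> e /= /andP[/existsP[j]]; rewrite G0.
pose J e := [arg max_(j > j0 | G j) affine_form j e]%O.
have GJ e : G (J e) by rewrite /J; case: arg_maxP.
have maxJ e j : G j -> affine_form j e <= affine_form (J e) e.
  by move=> Gj; rewrite /J; case: arg_maxP => //= ? _; apply.
have tau0 : 0 < s * 2 ^+ k.+1 by rewrite mulr_gt0// exprn_gt0.
have := max_anti_concentration_group t GJ maxJ d0 om0 wom tau0 L1 IL Gk.
set B := (X in cube_prob X * _ <= _) => hB.
have AB : cube_prob A <= cube_prob B :> R.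
  apply: le_cube_prob => e /= /andP[/existsP[j /and3P[Gj tj /forallP mj]] be].
  apply/andP; split; last exact: be. 
  have -> // : affine_form (J e) e = affine_form j e.
  by apply/eqP; rewrite eq_le maxJ// andbT; apply: (implyP (mj _)).
rewrite (le_trans AB)// -(@ler_pM2r _ ((s * 2 ^+ k) ^+ 2)) ?exprn_gt0 ?mulr_gt0//.
apply: (le_trans hB); rewrite le_eqVlt; apply/orP; left; apply/eqP.
by rewrite exprS exprVn; field; rewrite !gt_eqF.
Qed.

(** Littlewood--Offord bound for the maximum.  When the maximum lies in the
window, so does the maximum over the dyadic group of the maximizing row; the bound
for the group of norm [s * 2 ^+ k] decreases like [2^-1 ^+ k]. *)
Lemma max_anti_concentration (M : cube -> R) (t : R) :
  (forall e, exists j, M e = affine_form j e) ->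
  (forall e j, affine_form j e <= M e) ->
  (forall j, s ^+ 2 <= \sum_i w j i ^+ 2) ->
  cube_prob [pred e | t <= M e <= t + d] <=
    32 * (d + 2 * om) / s * Num.sqrt L +
    #|I|%:R * expR (- (s ^+ 2 / (32 * om ^+ 2))).
Proof.
move=> Mex Mmax sw.
have /boolp.choice[k hk] j : exists k : nat,
    (s * 2 ^+ k) ^+ 2 <= \sum_i w j i ^+ 2 <= (s * 2 ^+ k.+1) ^+ 2.
  exact: dyadic_bracket.
pose K := (\max_j k j).+1.
pose A (m : 'I_K) : pred cube := [pred e | [exists j, [&& k j == m :> nat,
  t <= affine_form j e <= t + d & [forall j', (k j' == m :> nat) ==>
    (affine_form j' e <= affine_form j e)]]] && balanced e].
have split_balanced e : t <= M e <= t + d ->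
    (t <= M e <= t + d) && balanced e || ~~ balanced e.
  by move=> ->; case: balanced.
apply: (le_trans (le_cube_prob split_balanced)).
apply: (le_trans (cube_probU _ _)); apply: lerD; last exact: cube_prob_unbalanced.
apply: (le_trans (cube_prob_exists (A := A) _)) => [e /= /andP[tM be]|].
  have [j Mj] := Mex e.
  have kjK : (k j < K)%N by rewrite ltnS leq_bigmax.
  exists (Ordinal kjK); rewrite /A/= be andbT; apply/existsP; exists j.
  rewrite eqxx -Mj tM/=; apply/forallP => j'; apply/implyP => _.
  exact: Mmax.
have bound (m : 'I_K) : cube_prob (A m) <=
    16 * (d + 2 * om) / s * Num.sqrt L * 2^-1 ^+ m.
  by apply: anti_concentration_dyadic => j /eqP <-; exact: hk.
apply: (le_trans (ler_sum _ (fun m _ => bound m))); rewrite -mulr_sumr.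
have -> : 32 * (d + 2 * om) / s * Num.sqrt L =
  16 * (d + 2 * om) / s * Num.sqrt L * 2 by ring.
rewrite ler_wpM2l ?sum_geometric_half//.
rewrite mulr_ge0 ?sqrtr_ge0// mulr_ge0//; first by have := om0; have := d0; lra.
by rewrite invr_ge0 ltW.
Qed.

End AntiConcentrationMax.

(** * Ranks and quantiles under random signs *)

Section Ranks.
Context {R : realType} {n : nat}.
Notation cube := {ffun 'I_n -> bool}.
Implicit Types (e : cube) (S : cube -> R).

Lemma cube_prob_eq0 (A : pred cube) : A =1 pred0 -> cube_prob A = 0 :> R.
Proof.
by move=> A0; rewrite /cube_prob /cube_mean big1 ?mulr0// => e _; rewrite A0.
Qed.

(** The values of strict rank at least [beta] all lie above the smallest of
them, which already exceeds a fraction [beta] of all values. *)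
Lemma cube_prob_rank_ge S (beta : R) : beta <= 1 ->
  cube_prob [pred e | beta <= cube_prob [pred e' | S e' < S e]] <= 1 - beta :> R.
Proof.
move=> beta1; set A := (X in cube_prob X <= _).
have [e0 Ae0|A0] := pickP A; last first.
  by rewrite cube_prob_eq0// subr_ge0.
pose m := [arg min_(e < e0 | A e) S e]%O.
have Am : A m by rewrite /m; case: arg_minP.
have mA e : A e -> S m <= S e by move=> Ae; rewrite /m; case: arg_minP => //= ? _; apply.
apply: (@le_trans _ _ (cube_prob (predC [pred e' | S e' < S m]))).
  by apply: le_cube_prob => e /mA /=; rewrite -leNgt.
by rewrite cube_probC lerD2l lerN2.
Qed.

(** All values of rank at most [beta] lie below the largest of them. *)
Lemma cube_prob_rank_le S (beta : R) : 0 <= beta ->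
  cube_prob [pred e | cube_prob [pred e' | S e' <= S e] <= beta] <= beta :> R.
Proof.
move=> beta0; set A := (X in cube_prob X <= _).
have [e0 Ae0|A0] := pickP A; last first.
  by rewrite cube_prob_eq0.
pose m := [arg max_(e > e0 | A e) S e]%O.
have Am : A m by rewrite /m; case: arg_maxP.
have mA e : A e -> S e <= S m by move=> Ae; rewrite /m; case: arg_maxP => //= ? _; apply.
by apply: le_trans Am; apply: le_cube_prob => e /mA.
Qed.

Lemma le_cube_prob_close S S' (close : pred cube) (y y' : R) :
  (forall e, close e -> S e <= y -> S' e <= y') ->
  cube_prob [pred e | S e <= y] <=
  cube_prob [pred e | S' e <= y'] + cube_prob (predC close) :> R.
Proof.
move=> SS; apply: le_trans (cube_probU _ _); apply: le_cube_prob => e /= Sy.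
by case: (boolP (close e)) => [ce|]; rewrite ?orbT// (SS e ce Sy).
Qed.

(** [S] stands for the randomization values and [S'] for their centred versions.
Moving from a quantile of [S'] to a rank of [S] costs the exceptional signs
[eta] and the mass [rho] of a window of twice the displacement. *)
Section quantile_rank.
Variables (S S' : cube -> R) (close : pred cube) (d eta rho : R).
Hypothesis S'S : forall e, close e -> `|S' e - S e| <= d.
Hypothesis close_eta : cube_prob (predC close) <= eta.
Hypothesis S_rho : forall t, cube_prob [pred e | t <= S e <= t + 2 * d] <= rho.

Lemma rank_ge_of_quantile_lt (beta q y : R) : q < y ->
  beta <= cube_prob [pred e | S' e <= q] ->
  beta - eta - rho <= cube_prob [pred e | S e < y].
Proof.
move=> qy bq.
have h1 : cube_prob [pred e | S' e <= q] <=
    cube_prob [pred e | S e <= y + 2 * d] + cube_prob (predC close) :> R.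
  apply: le_cube_prob_close => e ce S'q.
  by move: (S'S ce); rewrite ler_norml => /andP[h2 h3]; have := qy; lra.
have h2 : cube_prob [pred e | S e <= y + 2 * d] <=
    cube_prob [pred e | S e < y] + cube_prob [pred e | y <= S e <= y + 2 * d] :> R.
  apply: le_trans (cube_probU _ _); apply: le_cube_prob => e /= ->.
  by rewrite andbT; case: ltP.
have := S_rho y; have := close_eta; lra.
Qed.

Lemma rank_le_of_quantile_ge (beta q y : R) : y - d <= q ->
  cube_prob [pred e | S' e <= q] <= beta ->
  cube_prob [pred e | S e <= y] <= beta + eta + rho.
Proof.
move=> qy bq.
have h1 : cube_prob [pred e | S e <= y - 2 * d] <=
    cube_prob [pred e | S' e <= q] + cube_prob (predC close) :> R.
  apply: le_cube_prob_close => e ce S'q.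
  by move: (S'S ce); rewrite ler_norml => /andP[h2 h3]; lra.
have h2 : cube_prob [pred e | S e <= y] <=
    cube_prob [pred e | S e <= y - 2 * d] +
    cube_prob [pred e | y - 2 * d <= S e <= y - 2 * d + 2 * d] :> R.
  apply: le_trans (cube_probU _ _); apply: le_cube_prob => e /=.
  by rewrite subrK => ->; rewrite andbT; case: leP => //= /ltW.
have := S_rho (y - 2 * d); have := close_eta; lra.
Qed.

End quantile_rank.
End Ranks.

(** * Sign changes of the sample *)

Section MaxCoord.
Context {R : realType} {p : nat}.
Implicit Types f g : 'I_p -> R.

Lemma max_coord_le_dist f g (d : R) : (0 < p)%N ->
  (forall j, f j <= g j + d) -> max_coord f <= max_coord g + d.
Proof.
move=> p0 fg; have [[j ->] _] := max_coord_max f p0.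
have [_ mg] := max_coord_max g p0.
by rewrite (le_trans (fg j))// lerD2r.
Qed.

Lemma max_coord_dist f g (d : R) : (0 < p)%N ->
  (forall j, `|f j - g j| <= d) -> `|max_coord f - max_coord g| <= d.
Proof.
move=> p0 fg; rewrite ler_norml lerBrDl addrC lerBlDl -lerBrDl.
apply/andP; split; last first.
  apply: max_coord_le_dist => // j; have := fg j.
  by rewrite ler_norml => /andP[]; lra.
suff : max_coord g <= max_coord f + d by lra.
apply: max_coord_le_dist => // j; have := fg j.
by rewrite ler_norml => /andP[]; lra.
Qed.

End MaxCoord.

Section SignFlips.
Context {R : realType} {n p : nat}.
Notation cube := {ffun 'I_n -> bool}.
Notation sample := (n.-tuple (p.-tuple R)).
Implicit Types (e : cube) (x : sample) (a : p.-tuple R).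

Definition sign_flip e x : sample :=
  [tuple [tuple sgn e i * tnth (tnth x i) j | j < p] | i < n].

Definition sign_tuple e : n.-tuple R := [tuple sgn e i | i < n].

Definition cube_xor e e' : cube := [ffun i => e i (+) e' i].

Lemma cube_xorK e : involutive (cube_xor^~ e).
Proof. by move=> e'; apply/ffunP => i; rewrite !ffunE -addbA addbb addbF. Qed.

Lemma tnth_sign_flip e x i j :
  tnth (tnth (sign_flip e x) i) j = sgn e i * tnth (tnth x i) j.
Proof. by rewrite !tnth_mktuple. Qed.

Lemma sign_flip_comp e e' x :
  sign_flip e' (sign_flip e x) = sign_flip (cube_xor e' e) x.
Proof.
apply: eq_from_tnth => i; apply: eq_from_tnth => j.
rewrite !tnth_sign_flip mulrA; congr (_ * _).
by rewrite /sgn ffunE; case: (e i) (e' i) => -[];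
  rewrite /= ?expr0 ?expr1 ?mulr1 ?mul1r ?mulrNN ?mulr1.
Qed.

(** The orbit of [x] under sign changes does not depend on its base point. *)
Lemma cube_prob_sign_flip (A : pred sample) e x :
  cube_prob [pred e' | A (sign_flip e' (sign_flip e x))] =
  cube_prob [pred e' | A (sign_flip e' x)] :> R.
Proof.
rewrite /cube_prob /cube_mean [in RHS](reindex_inj (can_inj (cube_xorK e))).
by congr (_ * _); apply: eq_bigr => e' _ /=; rewrite sign_flip_comp.
Qed.

Definition rademacher_row x (j : 'I_p) (i : 'I_n) : R :=
  (Num.sqrt n%:R)^-1 * tnth (tnth x i) j.

Definition shift a (j : 'I_p) : R := (Num.sqrt n%:R)^-1 * \sum_(i < n) tnth a j.

(** The randomization values are maxima of affine forms, to which the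
anti-concentration bound applies. *)
Lemma max_stat_sign_flip a e x : max_stat a (sign_flip e x) =
  max_coord (fun j => affine_form (rademacher_row x) (shift a) j e).
Proof.
congr max_coord; apply/funext => j; rewrite /affine_form /shift.
rewrite big_split/= mulrDr addrC; congr (_ + _).
rewrite mulr_sumr; apply: eq_bigr => i _.
by rewrite tnth_sign_flip /rademacher_row mulrCA mulrC.
Qed.

(** Centring shifts the [j]-th coordinate by the sample mean times the normalized
sum of the signs, the same sum for all [j]. *)
Lemma max_stat_multiplier_dist a e x (s r : R) : (0 < p)%N -> 0 <= s ->
  `|\sum_(i < n) (Num.sqrt n%:R)^-1 * sgn e i| <= s ->
  (forall j, `|sample_mean x j| <= r) ->
  `|max_stat a (multiplier_sample (sign_tuple e) x) - max_stat a (sign_flip e x)|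
    <= s * r.
Proof.
move=> p0 s0 es xr; apply: max_coord_dist => // j.
rewrite -mulrBr -sumrB.
under eq_bigr => i _ do rewrite !tnth_mktuple opprD addrACA subrr addr0 mulrBr
  addrAC subrr add0r mulrC -mulNr.
rewrite -mulr_sumr mulrCA normrM normrN mulrC mulr_sumr.
by apply: ler_pM => //; exact: xr.
Qed.

End SignFlips.

(** * Independent families *)

Section IntegralMul.
Context {d : measure_display} {T : measurableType d} {R : realType}
  (P : {measure set T -> \bar R}) {d' : measure_display} {U : measurableType d'}.
Variables (G : T -> R) (Y : T -> U) (c : R).
Hypotheses (mG : measurable_fun setT G) (G0 : forall w, 0 <= G w).
Hypotheses (mY : measurable_fun setT Y) (c0 : 0 <= c).

Import HBNNSimple.
Local Open Scope ereal_scope.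

Let dominated (f : U -> R) :=
  \int[P]_w (G w * f (Y w))%:E <= c%:E * \int[P]_w (f (Y w))%:E.

Let mcomp (f : U -> R) : measurable_fun setT f ->
  measurable_fun setT (fun w => f (Y w)).
Proof. by move=> mf; exact: measurableT_comp. Qed.

Let mGf (f : U -> R) : measurable_fun setT f ->
  measurable_fun setT (fun w => (G w * f (Y w))%R).
Proof. by move=> mf; apply: measurable_funM => //; exact: mcomp. Qed.

Let dominated_sum (s : seq R) (h : R -> U -> R) :
  (forall r, measurable_fun setT (h r)) -> (forall r u, (0 <= h r u)%R) ->
  (forall r, dominated (h r)) -> dominated (fun u => \sum_(r <- s) h r u)%R.
Proof.
move=> mh h0 hD; rewrite /dominated.
under eq_integral => w _ do rewrite mulr_sumr -sumEFin.
under [in leRHS]eq_integral => w _ do rewrite -sumEFin.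
rewrite ge0_integral_sum//; last 2 first.
- by move=> r; apply/measurable_EFinP; exact: mGf.
- by move=> r w _; rewrite lee_fin mulr_ge0.
rewrite ge0_integral_sum//; last 2 first.
- by move=> r; apply/measurable_EFinP; exact: mcomp.
- by move=> r w _; rewrite lee_fin.
rewrite ge0_sume_distrr; last by move=> r _; apply: integral_ge0 => w _; rewrite lee_fin.
by apply: lee_sum => r _; exact: hD.
Qed.

(** Both sides are linear and monotone continuous in [f]: the inequality passes
from indicators to simple functions, and to increasing limits of these. *)
Lemma integral_mul_le_of_indic :
  (forall A, measurable A ->
     \int[P]_w (G w * \1_A (Y w))%:E <= c%:E * P (Y @^-1` A)) ->
  forall f : U -> R, measurable_fun setT f -> (forall u, (0 <= f u)%R) ->
  \int[P]_w (G w * f (Y w))%:E <= c%:E * \int[P]_w (f (Y w))%:E.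
Proof.
move=> hA f mf f0.
have mfE : measurable_fun setT (fun u => (f u)%:E) by exact/measurable_EFinP.
pose h := nnsfun_approx measurableT mfE.
have simple (g : {nnsfun U >-> R}) : dominated g.
  pose hr (r : R) (u : U) : R := (Num.max 0 r * \1_(g @^-1` [set r]) u)%R.
  have max0 (r : R) : (0 <= Num.max 0 r)%R by rewrite le_max lexx.
  have [s gE] : exists s : seq R, (g : U -> R) = (fun u => \sum_(r <- s) hr r u)%R.
    eexists; apply/funext => u; rewrite fimfunE fsbig_finite//; apply: eq_bigr => r _.
    rewrite /hr; case: (lerP 0%R r) => // r0.
    by rewrite (preimage_nnfun0 _ r0) indicE in_set0 !mulr0.
  rewrite gE; apply: dominated_sum.
  - by move=> r; apply: measurable_funM => //; exact: measurable_indic.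
  - by move=> r u; rewrite mulr_ge0.
  move=> r; rewrite /dominated /hr; move: (max0 r) => r0.
  have mA : measurable (g @^-1` [set r]) by [].
  have mYA : measurable (Y @^-1` (g @^-1` [set r])).
    by rewrite -[X in measurable X]setTI; exact: mY.
  under eq_integral => w _ do rewrite mulrCA EFinM.
  rewrite ge0_integralZl//; last 2 first.
  - by apply/measurable_EFinP; apply: mGf; exact: measurable_indic.
  - by move=> w _; rewrite lee_fin mulr_ge0.
  under [in leRHS]eq_integral => w _ do rewrite EFinM.
  rewrite ge0_integralZl//; last first.
    by apply/measurable_EFinP; apply: mcomp; exact: measurable_indic.
  rewrite muleCA lee_wpmul2l ?lee_fin//.
  apply: (le_trans (hA _ mA)); rewrite lee_wpmul2l ?lee_fin//.
  have -> : \int[P]_w (\1_(g @^-1` [set r]) (Y w))%:E =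
      \int[P]_w (\1_(Y @^-1` (g @^-1` [set r])) w)%:E by [].
  by rewrite integral_indic// setIT.
have mh n : measurable_fun setT (h n : U -> R) by [].
have nd u (m n : nat) : (m <= n)%N -> (h m u <= h n u)%R.
  by move=> mn; apply/lefP/nd_nnsfun_approx.
have hf u : (fun n => (h n u)%:E) @ \oo --> (f u)%:E.
  by apply: cvg_nnsfun_approx => // v _; rewrite lee_fin.
have -> : \int[P]_w (G w * f (Y w))%:E =
    \int[P]_w (limn (fun n => (G w * h n (Y w))%:E)).
  apply: eq_integral => w _; apply/esym/cvg_lim => //.
  under eq_fun do rewrite EFinM.
  by rewrite EFinM; apply: cvgeZl => //; exact: hf.
rewrite monotone_convergence//; last 3 first.
- by move=> n; apply/measurable_EFinP; exact: mGf.
- by move=> n w _; rewrite lee_fin mulr_ge0.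
- by move=> w _ m n mn; rewrite lee_fin ler_wpM2l// nd.
apply: lime_le.
  apply: ereal_nondecreasing_is_cvgn => m n mn; apply: ge0_le_integral => //.
  - by move=> w _; rewrite lee_fin mulr_ge0.
  - by apply/measurable_EFinP; exact: mGf.
  - by apply/measurable_EFinP; exact: mGf.
  - by move=> w _; rewrite lee_fin ler_wpM2l// nd.
apply: nearW => n; apply: (le_trans (simple (h n))).
rewrite lee_wpmul2l ?lee_fin//; apply: ge0_le_integral => //.
- by move=> w _; rewrite lee_fin.
- by apply/measurable_EFinP; exact: mcomp.
- by apply/measurable_EFinP; exact: mcomp.
move=> w _; have := hf (Y w); move/cvg_lim => <- //.
apply: lime_ge; first exact: cvgP (hf (Y w)).
by exists n => // m /= nm; rewrite lee_fin nd.
Qed.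

End IntegralMul.

Section Independence.
Context {d : measure_display} {T : measurableType d} {R : realType}
  (P : probability T R) {d' : measure_display} {U : measurableType d'} {n : nat}.
Variable X : 'I_n -> T -> U.
Hypothesis mX : forall i, measurable_fun setT (X i).
Hypothesis indepX : mutually_independent P X.

Let mprod (F : 'I_n -> U -> R) (p : pred 'I_n) : (forall i, measurable_fun setT (F i)) ->
  measurable_fun setT (fun w => \prod_(i | p i) F i (X i w)).
Proof.
move=> mF; under eq_fun do rewrite big_mkcond.
apply: measurable_prod => i _; case: (p i) => //; exact: measurableT_comp.
Qed.

(** One half of the product formula for expectations.  Indicators are replaced by
general functions one coordinate at a time: with the other factors kept fixed,
the case of an indicator at coordinate [k] is the domination required by
[integral_mul_le_of_indic]. *)
Lemma expectation_prod_le (F : 'I_n -> U -> R) (c : 'I_n -> R) :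
  (forall i, measurable_fun setT (F i)) -> (forall i u, 0 <= F i u) ->
  (forall i, (\int[P]_w (F i (X i w))%:E <= (c i)%:E)%E) ->
  (\int[P]_w (\prod_i F i (X i w))%:E <= (\prod_i c i)%:E)%E.
Proof.
suff main (m : nat) : forall (F : 'I_n -> U -> R) (c : 'I_n -> R),
  (forall i, measurable_fun setT (F i)) -> (forall i u, 0 <= F i u) ->
  (forall i, (\int[P]_w (F i (X i w))%:E <= (c i)%:E)%E) ->
  (forall i : 'I_n, (m <= i)%N -> exists2 A, measurable A & F i = \1_A) ->
  (\int[P]_w (\prod_i F i (X i w))%:E <= (\prod_i c i)%:E)%E.
  move=> mF F0 Fc; apply: (main n) => // i; by rewrite leqNgt ltn_ord.
elim: m => [|m IH] {}F {}c mF F0 Fc Findic.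
  have /boolp.choice[A hA] i : exists A, measurable A /\ F i = \1_A.
    by have [A mA FA] := Findic i isT; exists A.
  have mA i : measurable (A i) by case: (hA i).
  have mXA i : measurable (X i @^-1` A i).
    by rewrite -[X in measurable X]setTI; exact: mX.
  have -> : (fun w => (\prod_i F i (X i w))%:E) =
      (fun w => (\1_(\bigcap_(i in [set` finset.setTfor 'I_n]) X i @^-1` A i) w)%:E).
    apply/funext => w; congr (_%:E); rewrite indicE.
    have [wA|wA] := boolP (w \in _).
      rewrite big1// => i _; have [_ ->] := hA i; rewrite indicE mem_set//.
      by move: wA; rewrite inE => /(_ i); apply; rewrite /= inE.
    apply/eqP; rewrite prodf_seq_eq0; apply/hasP.
    move: wA; rewrite notin_setE => /existsNP[i /not_implyP[_ wi]].
    exists i; first by rewrite mem_index_enum.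
    by have [_ ->] := hA i; rewrite /= indicE memNset.
  rewrite integral_indic ?setIT//; last first.
    by apply: fin_bigcap_measurable => // i _; exact: mXA.
  rewrite [leLHS](_ : _ = \prod_(i in finset.setTfor 'I_n) P (X i @^-1` A i))%E;
    last exact: (indepX (finset.setTfor 'I_n) mA).
  have PA i : P (X i @^-1` A i) = (fine (P (X i @^-1` A i)))%:E.
    by rewrite fineK// fin_num_measure.
  rewrite (eq_bigr (fun i => (fine (P (X i @^-1` A i)))%:E)); last first.
    by move=> i _; exact: PA.
  rewrite prodEFin lee_fin.
  have -> : \prod_(i in finset.setTfor 'I_n) fine (P (X i @^-1` A i)) =
      \prod_i fine (P (X i @^-1` A i)) by apply: eq_bigl => i; rewrite inE.
  apply: ler_prod => i _; rewrite fine_ge0//= -lee_fin -PA.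
  apply: le_trans (Fc i); have [_ ->] := hA i.
  have -> : (\int[P]_w (\1_(A i) (X i w))%:E = \int[P]_w (\1_(X i @^-1` A i) w)%:E)%E by [].
  by rewrite integral_indic// setIT.
have [mn|nm] := ltnP m n; last first.
  apply: IH => // i mi; exfalso; move: (ltn_ord i); by rewrite ltnNge (leq_trans nm mi).
pose k := Ordinal mn.
pose c' := \prod_(i | i != k) c i.
have c0 i : 0 <= c i.
  by rewrite -lee_fin (le_trans _ (Fc i))// integral_ge0// => w _; rewrite lee_fin.
have c'0 : 0 <= c' by apply: prodr_ge0.
rewrite (bigD1 k)//= mulrC EFinM.
have -> : (fun w => (\prod_i F i (X i w))%:E) =
    (fun w => (\prod_(i | i != k) F i (X i w) * F k (X k w))%:E).
  by apply/funext => w; rewrite (bigD1 k)//= mulrC.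
apply: (@le_trans _ _ (c'%:E * \int[P]_w (F k (X k w))%:E)%E); last first.
  by rewrite lee_wpmul2l ?lee_fin.
apply: integral_mul_le_of_indic => //.
- exact: mprod.
- by move=> w; apply: prodr_ge0.
move=> A mA; have mXA : measurable (X k @^-1` A).
  by rewrite -[X in measurable X]setTI; exact: mX.
have PA : (fine (P (X k @^-1` A)))%:E = P (X k @^-1` A).
  by rewrite fineK// fin_num_measure.
pose F' i : U -> R := if i == k then \1_A else F i.
pose c'' i := if i == k then fine (P (X k @^-1` A)) else c i.
have F'k : F' k = \1_A by rewrite /F' eqxx.
have F'i i : i != k -> F' i = F i by move=> /negbTE ik; rewrite /F' ik.
have c''E : (\prod_i c'' i)%:E = (c'%:E * P (X k @^-1` A))%E.
  rewrite (bigD1 k)//= /c'' eqxx EFinM PA muleC; congr (_%:E * _)%E.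
  by apply: eq_bigr => i /negbTE ->.
have F'E : (fun w => (\prod_i F' i (X i w))%:E) =
    (fun w => (\prod_(i | i != k) F i (X i w) * \1_A (X k w))%:E).
  apply/funext => w; rewrite (bigD1 k)//= F'k mulrC; congr (_ * _)%:E.
  by apply: eq_bigr => i ik; rewrite F'i.
have := IH F' c''; rewrite c''E F'E.
apply.
- by move=> i; rewrite /F'; case: eqP => // _; exact: measurable_indic.
- by move=> i u; rewrite /F'; case: eqP => // _.
- move=> i; rewrite /F' /c''; case: eqP => [->|//]; rewrite PA.
  have -> : (\int[P]_w (\1_A (X k w))%:E = \int[P]_w (\1_(X k @^-1` A) w)%:E)%E by [].
  by rewrite integral_indic// setIT.
move=> i mi; rewrite /F'; case: eqP => [_|ik]; first by exists A.
apply: Findic; rewrite ltn_neqAle mi andbT; apply/eqP => mE; apply: ik.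
exact/val_inj.
Qed.

(** Chernoff's bound for a sum of functions of independent variables. *)
Lemma probability_sum_ge (f : 'I_n -> U -> R) (c : 'I_n -> R) (s : R) :
  (forall i, measurable_fun setT (f i)) ->
  (forall i, (\int[P]_w (expR (f i (X i w)))%:E <= (expR (c i))%:E)%E) ->
  (P [set w | s <= \sum_i f i (X i w)]%R <= (expR (\sum_i c i - s))%:E)%E.
Proof.
move=> mf fc.
pose S w := \sum_i f i (X i w).
have mS : measurable_fun setT S.
  by apply: measurable_sum => i; exact: measurableT_comp.
have mE : measurable [set w | s <= S w].
  by rewrite -[X in measurable X]setTI; apply: measurable_fun_ler.
rewrite -[X in P X]setIT -integral_indic//.
have h := @expectation_prod_le (fun i u => expR (f i u)) (fun i => expR (c i)).
apply: (@le_trans _ _ (\int[P]_w ((expR (- s))%:E * (\prod_i expR (f i (X i w)))%:E))%E).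
  apply: ge0_le_integral => //.
  - by apply/measurable_EFinP; exact: measurable_indic.
  - under eq_fun do rewrite -EFinM.
    apply/measurable_EFinP; apply: measurable_funM => //.
    apply: (mprod (F := fun i u => expR (f i u)) xpredT) => i.
    exact: measurableT_comp.
  move=> w _; rewrite -EFinM lee_fin -expR_sum -expRD indicE.
  have [ws|ws] := boolP (w \in _); last exact: expR_ge0.
  rewrite -expR0 ler_expR addrC subr_ge0.
  by move: ws; rewrite inE.
rewrite ge0_integralZl//; last 2 first.
- apply/measurable_EFinP; apply: (mprod (F := fun i u => expR (f i u)) xpredT) => i.
  exact: measurableT_comp.
- by move=> w _; rewrite lee_fin prodr_ge0// => i _; exact: expR_ge0.
rewrite addrC expRD EFinM expR_sum lee_wpmul2l ?lee_fin ?expR_ge0//.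
by apply: h => // i; exact: measurableT_comp.
Qed.

End Independence.

Section JointLaw.
Context {d : measure_display} {T : measurableType d} {R : realType}
  (P : probability T R) {d' : measure_display} {U : measurableType d'} {n : nat}.

Definition box (A : 'I_n -> set U) : set (n.-tuple U) :=
  [set x | forall i, A i (tnth x i)].

Lemma measurable_joint (X : 'I_n -> T -> U) :
  (forall i, measurable_fun setT (X i)) -> measurable_fun setT (joint X).
Proof.
move=> mX; apply/measurable_fun_tnthP => i.
have -> // : (@tnth n U)^~ i \o joint X = X i.
by apply/funext => w; rewrite /= /joint tnth_mktuple.
Qed.

Lemma preimage_box (X : 'I_n -> T -> U) (A : 'I_n -> set U) :
  joint X @^-1` box A = \bigcap_(i in [set` finset.setTfor 'I_n]) X i @^-1` A i.
Proof.
apply/seteqP; split => w /= h i; first by have := h i; rewrite tnth_mktuple.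
by rewrite tnth_mktuple; apply: h; rewrite /= finset.in_setT.
Qed.

(** Boxes are stable under intersection, unlike the preimages of the single
coordinates that define the sigma-algebra. *)
Lemma measurable_box_generated :
  @measurable _ (n.-tuple U) =
  <<s [set B | exists2 A : 'I_n -> set U, (forall i, measurable (A i)) & B = box A] >>.
Proof.
apply/seteqP; split.
  apply: smallest_sub; first exact: smallest_sigma_algebra.
  rewrite -bigcup_seq; apply: bigcup_sub => i _ B [A mA <-].
  apply: sub_sigma_algebra; exists (fun k => if k == i then A else setT).
    by move=> k; case: eqP.
  apply/seteqP; split => [x [_ /= xA] k|x /= /(_ i)]; last by rewrite eqxx.
  by case: eqP => [->|].
apply: smallest_sub; first exact: sigma_algebra_measurable.
move=> _ [A mA ->].
have -> : box A = \bigcap_(i in [set` finset.setTfor 'I_n])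
    ((fun x : n.-tuple U => tnth x i) @^-1` A i).
  apply/seteqP; split => x /= h i; first by move=> _; exact: h.
  by apply: h; rewrite /= finset.in_setT.
apply: fin_bigcap_measurable => // i _.
by rewrite -[X in measurable X]setTI; apply: measurable_tnth.
Qed.

(** Independence makes the two joint laws agree on the pi-system of boxes. *)
Lemma eq_joint_law (X Y : 'I_n -> T -> U) :
  (forall i, measurable_fun setT (X i)) -> (forall i, measurable_fun setT (Y i)) ->
  mutually_independent P X -> mutually_independent P Y ->
  (forall i, identically_distributed P (X i) (Y i)) ->
  forall A, measurable A -> P (joint X @^-1` A) = P (joint Y @^-1` A).
Proof.
move=> mX mY iX iY XY A mA.
pose G := [set B | exists2 A : 'I_n -> set U, (forall i, measurable (A i)) & B = box A].
have mjX := measurable_joint mX; have mjY := measurable_joint mY.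
pose jX : {mfun T >-> n.-tuple U} := HB.pack (joint X) (isMeasurableFun.Build _ _ _ _ _ mjX).
pose jY : {mfun T >-> n.-tuple U} := HB.pack (joint Y) (isMeasurableFun.Build _ _ _ _ _ mjY).
apply: (@measure_unique _ R (n.-tuple U) G (fun=> setT) _ _ _ _
  (distribution P jX) (distribution P jY)) => //.
- exact: measurable_box_generated.
- move=> _ _ [B mB ->] [C mC ->]; exists (fun i => B i `&` C i).
    by move=> i; exact: measurableI.
  by apply/seteqP; split => [x [hB hC] i|x h]; [split|split => i; case: (h i)].
- by move=> _; exists (fun=> setT) => //; apply/seteqP.
- exact: bigcup_const.
- move=> _ [B mB ->]; change (P (joint X @^-1` box B) = P (joint Y @^-1` box B)).
  rewrite !preimage_box.
  rewrite [LHS](iX (finset.setTfor 'I_n) B mB) [RHS](iY (finset.setTfor 'I_n) B mB).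
  by apply: eq_bigr => i _; exact: XY.
- by move=> _; rewrite (le_lt_trans (probability_le1 _ _))// ltry.
Qed.

End JointLaw.

(** * Moment generating functions *)

Section Moments.
Context {d : measure_display} {T : measurableType d} {R : realType}
  (P : probability T R).
Variable Y : T -> R.
Hypothesis mY : measurable_fun setT Y.

Let mexp (g : T -> R) : measurable_fun setT g ->
  measurable_fun setT (fun w => (expR (g w))%:E).
Proof. by move=> mg; apply/measurable_EFinP; exact: measurableT_comp. Qed.

(** The exponent is at most 0, so the quadratic bound on [expR] applies, and its
last term is a fourth moment. *)
Lemma mgf_opp_sqr_le (l a b : R) : 0 <= l ->
  ('E_P[fun w => (Y w ^+ 2)%R] = a%:E)%E -> ('E_P[fun w => (Y w ^+ 4)%R] = b%:E)%E ->
  (\int[P]_w (expR (- (l * Y w ^+ 2)))%:E <= (expR (2 * l ^+ 2 * b - l * a))%:E)%E.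
Proof.
rewrite unlock => l0 Ea Eb.
have mY2 : measurable_fun setT (fun w => Y w ^+ 2) by exact: measurable_funX.
have mY4 : measurable_fun setT (fun w => Y w ^+ 4) by exact: measurable_funX.
have mlY2 : measurable_fun setT (fun w => (l * Y w ^+ 2)%:E).
  by apply/measurable_EFinP; exact: measurable_funM.
have mnlY2 : measurable_fun setT (fun w => - (l * Y w ^+ 2)).
  by apply: measurableT_comp => //; exact: measurable_funM.
have Y40 w : 0 <= Y w ^+ 4 by rewrite -[4%N]/(2 * 2)%N exprM sqr_ge0.
have lY20 w : 0 <= l * Y w ^+ 2 by rewrite mulr_ge0// sqr_ge0.
have l20 : 0 <= 2 * l ^+ 2 by rewrite mulr_ge0// sqr_ge0.
have sum_le : (\int[P]_w (expR (- (l * Y w ^+ 2)))%:E + (l * a)%:E <=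
    (1 + 2 * l ^+ 2 * b)%:E)%E.
  rewrite EFinM -Ea -ge0_integralZl//; last 2 first.
  - exact/measurable_EFinP.
  - by move=> w _; rewrite lee_fin sqr_ge0.
  under [X in (_ + X)%E]eq_integral => w _ do rewrite -EFinM.
  rewrite -ge0_integralD//; last 2 first.
  - exact: mexp.
  - by move=> w _; rewrite lee_fin.
  have -> : (1 + 2 * l ^+ 2 * b)%:E =
      (\int[P]_w (1 + (2 * l ^+ 2 * Y w ^+ 4)%:E))%E.
    rewrite ge0_integralD//; last 2 first.
    - by move=> w _; rewrite lee_fin mulr_ge0.
    - by apply/measurable_EFinP; exact: measurable_funM.
    rewrite integral_cst//= probability_setT mul1e.
    under eq_integral => w _ do rewrite EFinM.
    rewrite ge0_integralZl//; last 2 first.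
    - exact/measurable_EFinP.
    - by move=> w _; rewrite lee_fin.
    by rewrite Eb EFinD EFinM.
  apply: ge0_le_integral => //.
  - by move=> w _; rewrite -EFinD lee_fin addr_ge0// expR_ge0.
  - by apply: emeasurable_funD => //; exact: mexp.
  - apply: emeasurable_funD => //.
    by apply/measurable_EFinP; exact: measurable_funM.
  move=> w _; rewrite -!EFinD lee_fin.
  have h : - (l * Y w ^+ 2) <= 2^-1 by have := lY20 w; lra.
  have := expR_le_quad h; rewrite sqrrN exprMn -exprM; lra.
apply: (@le_trans _ _ (1 + (2 * l ^+ 2 * b - l * a))%:E); last first.
  by rewrite lee_fin expR_ge1Dx.
rewrite addrA EFinB leeBrDr//.
Qed.

(** Since [`|l * y|] is at most half of [`|y| / B], the other half of the
exponential absorbs the square. *)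
Lemma sqr_mul_expR_le (B l y : R) : 0 < B -> `|l| <= (2 * B)^-1 ->
  (l * y) ^+ 2 * expR `|l * y| <= 16 * (l * B) ^+ 2 * expR (`|y| / B).
Proof.
move=> B0 lB; set z := `|y| / B / 2.
have z0 : 0 <= z by rewrite !divr_ge0// ltW.
have ly : `|l * y| <= z.
  have -> : z = (2 * B)^-1 * `|y| by rewrite /z; field; rewrite gt_eqF.
  by rewrite normrM ler_wpM2r.
have h1 : expR `|l * y| <= expR z by rewrite ler_expR.
have h2 : expR (`|y| / B) = expR z * expR z by rewrite -expRD /z -splitr.
have h3 : z ^+ 2 <= 4 * expR z.
  have -> : expR z = expR (z / 2) * expR (z / 2) by rewrite -expRD -splitr.
  have := expR_ge1Dx (z / 2); nra.
have -> : (l * y) ^+ 2 = 4 * (l * B) ^+ 2 * z ^+ 2.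
  rewrite exprMn -[y ^+ 2]real_normK ?num_real// /z.
  by field; rewrite gt_eqF.
rewrite h2 mulrA; apply: ler_pM => //.
  by have := sqr_ge0 (l * B); have := sqr_ge0 z; nra.
by have := sqr_ge0 (l * B); nra.
Qed.

Lemma mgf_le_of_expR_moment (B l : R) : 0 < B -> `|l| <= (2 * B)^-1 ->
  ('E_P[Y] = 0)%E -> ('E_P[fun w => expR (`|Y w| / B)%R] <= 2%:E)%E ->
  (\int[P]_w (expR (l * Y w))%:E <= (expR (128 * (l * B) ^+ 2))%:E)%E.
Proof.
rewrite unlock => B0 lB EY EexpY.
have mexpY : measurable_fun setT (fun w => expR (`|Y w| / B)).
  apply: measurableT_comp => //; apply: measurable_funM => //.
  exact: measurableT_comp.
have iexpY : P.-integrable setT (fun w => (expR (`|Y w| / B))%:E).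
  apply/integrableP; split; first exact/measurable_EFinP.
  apply: le_lt_trans (ltry 2); apply: le_trans EexpY; rewrite le_eqVlt; apply/orP; left.
  by apply/eqP; apply: eq_integral => w _; rewrite gee0_abs// lee_fin expR_ge0.
have iY : P.-integrable setT (fun w => (Y w)%:E).
  apply: (@le_integrable _ _ _ P setT measurableT (fun w => (Y w)%:E)
    (fun w => (B * expR (`|Y w| / B))%:E)).
  - exact/measurable_EFinP.
  - move=> w _ /=; rewrite lee_fin [leRHS]ger0_norm; last first.
      by rewrite mulr_ge0 ?expR_ge0// ltW.
    rewrite mulrC -ler_pdivrMr//.
    by have := expR_ge1Dx (`|Y w| / B); lra.
  - under eq_fun do rewrite EFinM.
    exact: integrableZl.
pose K := 64 * (l * B) ^+ 2.
have K0 : 0 <= K by rewrite mulr_ge0// sqr_ge0.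
apply: (@le_trans _ _ (\int[P]_w ((1 + K * expR (`|Y w| / B))%:E + (l * Y w)%:E))%E).
  apply: ge0_le_integral => //.
  - apply: mexp; exact: measurable_funM.
  - apply: emeasurable_funD; apply/measurable_EFinP; last exact: measurable_funM.
    by apply: measurable_funD => //; exact: measurable_funM.
  move=> w _; rewrite -EFinD lee_fin.
  have := expR_le_quad_expR (l * Y w).
  have := sqr_mul_expR_le (Y w) B0 lB; rewrite /K; lra.
rewrite integralD//; last 2 first.
- under eq_fun do rewrite EFinD EFinM.
  apply: integrableD => //.
    exact: finite_measure_integrable_cst.
  exact: integrableZl.
- under eq_fun do rewrite EFinM.
  exact: integrableZl.
have -> : (\int[P]_w (l * Y w)%:E = 0)%E.
  under eq_integral => w _ do rewrite EFinM.
  by rewrite integralZl// EY mule0.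
rewrite adde0.
under eq_integral => w _ do rewrite EFinD EFinM.
rewrite ge0_integralD//; last 2 first.
- by move=> w _; rewrite -EFinM lee_fin mulr_ge0// expR_ge0.
- under eq_fun do rewrite -EFinM.
  by apply/measurable_EFinP; exact: measurable_funM.
rewrite integral_cst//= probability_setT mule1.
rewrite ge0_integralZl//; last first.
  exact/measurable_EFinP.
apply: (@le_trans _ _ (1 + K%:E * 2%:E)%E).
  by rewrite leeD2l// lee_wpmul2l// lee_fin.
rewrite -EFinM -EFinD lee_fin.
have -> : 1 + K * 2 = 1 + 128 * (l * B) ^+ 2 by rewrite /K; lra.
exact: expR_ge1Dx.
Qed.

Lemma probability_norm_gt (B L : R) : 0 < B ->
  ('E_P[fun w => expR (`|Y w| / B)%R] <= 2%:E)%E ->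
  (P [set w | B * L < `|Y w|]%R <= (2 * expR (- L))%:E)%E.
Proof.
rewrite unlock => B0 EexpY.
have mexpY : measurable_fun setT (fun w => expR (`|Y w| / B)).
  apply: measurableT_comp => //; apply: measurable_funM => //.
  exact: measurableT_comp.
have mE : measurable [set w | B * L < `|Y w|].
  rewrite -[X in measurable X]setTI; apply: measurable_fun_ltr => //.
  exact: measurableT_comp.
rewrite -[X in P X]setIT -integral_indic//.
apply: (@le_trans _ _ (\int[P]_w ((expR (- L))%:E * (expR (`|Y w| / B))%:E))%E).
  apply: ge0_le_integral => //.
  - by apply/measurable_EFinP; exact: measurable_indic.
  - under eq_fun do rewrite -EFinM.
    by apply/measurable_EFinP; exact: measurable_funM.
  move=> w _; rewrite -EFinM lee_fin -expRD indicE.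
  have [ws|ws] := boolP (w \in _); last exact: expR_ge0.
  rewrite -expR0 ler_expR addrC subr_ge0 ler_pdivlMr// mulrC ltW//.
  by move: ws; rewrite inE.
rewrite ge0_integralZl//; last first.
  exact/measurable_EFinP.
by rewrite mulrC EFinM lee_wpmul2l// lee_fin expR_ge0.
Qed.

End Moments.

(** * The critical value and the bootstrap distribution *)

Section RationalQuantile.
Context {R : realType}.

Definition nth_rat (i : nat) : R := ratr (odflt 0%Q (choice.unpickle i : option rat)).

Lemma nth_rat_dense (x y : R) : x < y -> exists i, x < nth_rat i < y.
Proof.
move=> /rat_in_itvoo[q]; rewrite in_itv/= => qxy.
by exists (choice.pickle q); rewrite /nth_rat choice.pickleK.
Qed.

(** Tightness of [mu] makes the set defining the quantile nonempty and bounded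
below, so that its infimum is a genuine one; rational thresholds then suffice by
monotonicity.  This makes the comparison with the quantile a countable
condition. *)
Lemma quantile_lt (mu : {measure set R -> \bar R}) (g y : R) :
  mu setT = 1%E -> 0 < g -> g < 1 ->
  (quantile mu g < y) <->
  (exists i, (g%:E <= mu `]-oo, nth_rat i]%classic)%E /\ nth_rat i < y).
Proof.
move=> mu1 g0 g1; pose A := [set t | (g%:E <= mu `]-oo, t]%classic)%E].
have mono (s t : R) : s <= t -> (mu `]-oo, s]%classic <= mu `]-oo, t]%classic)%E.
  move=> st; apply: le_measure; rewrite ?inE; [exact: measurable_itv..|].
  by apply: subset_itvl; rewrite bnd_simp.
have mU (F : (set R)^nat) (l : R) : (l%:E < mu (\bigcup_n F n))%E ->
    (forall n, measurable (F n)) -> {homo F : n m / (n <= m)%N >-> (n <= m)%O} ->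
    exists n, (l%:E < mu (F n))%E.
  move=> lF mF ndF; have := @nondecreasing_cvg_mu _ _ _ mu F mF.
  move=> /(_ (bigcupT_measurable _ mF) ndF) cvgF.
  apply: contrapT => /forallNP h; move: lF; apply/negP; rewrite -leNgt.
  rewrite -(cvg_lim _ cvgF)//; apply: lime_le; first exact: cvgP cvgF.
  by apply: nearW => n /=; rewrite leNgt; apply/negP/h.
have A0 : A !=set0.
  have [n hn] : exists n : nat, (g%:E < mu `]-oo, n%:R]%classic)%E.
    apply: (mU (fun n => `]-oo, n%:R]%classic)) => //.
    - have -> : \bigcup_n `]-oo, (n%:R : R)]%classic = setT.
        apply/seteqP; split => // x _; exists (Num.trunc x).+1 => //=.
        by rewrite in_itv/= ltW// truncnS_gt.
      by rewrite mu1 lte_fin.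
    - by move=> n m nm; apply/subsetPset; apply: subset_itvl; rewrite bnd_simp ler_nat.
  by exists n%:R; rewrite /A /= ltW.
have lbA : has_lbound A.
  have [n hn] : exists n : nat, ((1 - g)%:E < mu `](- n%:R)%R, +oo[%classic)%E.
    apply: (mU (fun n => `](- n%:R)%R, +oo[%classic)) => //.
    - have -> : \bigcup_n `]- (n%:R : R), +oo[%classic = setT.
        apply/seteqP; split => // x _; exists (Num.trunc (- x)).+1 => //=.
        by rewrite in_itv/= andbT ltrNl truncnS_gt.
      by rewrite mu1 lte_fin; lra.
    - by move=> n m nm; apply/subsetPset; apply: subset_itvr; rewrite bnd_simp lerN2 ler_nat.
  exists (- n%:R) => t; rewrite /A /= => gt; rewrite leNgt; apply/negP => tn.
  have := mono _ _ (ltW tn); move=> /(le_trans gt) {}gt.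
  have : (mu `]-oo, (- n%:R)%R]%classic + mu `](- n%:R)%R, +oo[%classic = 1)%E.
    rewrite -mu1 -measureU//; last 1 first.
    - apply/seteqP; split => // x []/=; rewrite !in_itv/= andbT => h1 h2.
      by have := le_lt_trans h1 h2; rewrite ltxx.
    congr (mu _); apply/seteqP; split => // x _ /=; rewrite !in_itv/= andbT.
    by case: (leP x (- n%:R)) => _; [left|right].
  have := lee_ltD _ gt hn; rewrite -EFinD addrC subrK => /(_ isT).
  by move=> /[swap] ->; rewrite ltxx.
split => [qy|[i [gi iy]]].
  have [t At ty] := inf_lt A0 qy.
  have [i /andP[ti iy]] := nth_rat_dense ty.
  exists i; split => //; apply: (le_trans At); apply: mono; exact: ltW.
apply: le_lt_trans iy; apply: ge_inf => //.
Qed.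

End RationalQuantile.

Section RademacherWeights.
Context {d : measure_display} {T : measurableType d} {R : realType}
  (P : probability T R) {n : nat}.
Notation cube := {ffun 'I_n -> bool}.
Variable (e : 'I_n -> T -> R).
Hypothesis me : forall i, measurable_fun setT (e i).
Hypothesis indep_e : mutually_independent P e.
Hypothesis rad_e : forall i, rademacher P (e i).

Lemma preimage_sign_tuple (c : cube) :
  joint e @^-1` [set @sign_tuple R n c] = joint e @^-1` box (fun i => [set sgn c i]).
Proof.
apply/seteqP; split => w /= h.
  by move=> i /=; rewrite h tnth_mktuple.
by apply: eq_from_tnth => i; rewrite h tnth_mktuple.
Qed.

Lemma measurable_sign_tuple (c : cube) : measurable [set @sign_tuple R n c].
Proof.
have -> : [set @sign_tuple R n c] = box (fun i => [set sgn c i]).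
  apply/seteqP; split => [x /= -> i /=|x /= h]; first by rewrite tnth_mktuple.
  by apply: eq_from_tnth => i; rewrite h tnth_mktuple.
rewrite measurable_box_generated; apply: sub_sigma_algebra.
by exists (fun i => [set sgn c i]) => // i; exact: measurable_set1.
Qed.

Lemma probability_sign_tuple (c : cube) :
  P (joint e @^-1` [set sign_tuple c]) = ((2 ^+ n)^-1)%:E.
Proof.
rewrite preimage_sign_tuple preimage_box.
have mc (i : 'I_n) : measurable [set sgn c i : R] by exact: measurable_set1.
rewrite [LHS](indep_e (finset.setTfor 'I_n) mc).
rewrite (eq_bigr (fun=> (2^-1)%:E)); last first.
  move=> i _; have [h1 h2] := rad_e i.
  by rewrite /sgn; case: (c i); rewrite ?expr0 ?expr1.
rewrite prodEFin prodr_const finset.cardsT card_ord exprVn//.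
Qed.

Lemma measurable_joint_sign (c : cube) : measurable (joint e @^-1` [set sign_tuple c]).
Proof.
rewrite -[X in measurable X]setTI.
by apply: (measurable_joint me) => //; exact: measurable_sign_tuple.
Qed.

Lemma sign_tuple_inj : injective (@sign_tuple R n).
Proof.
move=> c c' h; apply/ffunP => i.
have : sgn c i = sgn c' i :> R by rewrite -!(tnth_mktuple (fun i => sgn _ i)) -/(sign_tuple _) h.
rewrite /sgn {h}; case: (c i); case: (c' i) => //=; rewrite expr0 expr1 => h1; exfalso; lra.
Qed.

(** Total probability over the values of the weights.  The sum is at
most [P S] for every event [S]; for an event and its complement the two sums add up
to 1, which forces equality. *)
Lemma probability_sum_sign_tuple (S : set T) : measurable S ->
  P S = (\sum_(c : cube) P (S `&` joint e @^-1` [set sign_tuple c]))%E.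
Proof.
pose E (c : cube) := joint e @^-1` [set sign_tuple c].
have le1 (S' : set T) : measurable S' -> (\sum_(c : cube) P (S' `&` E c) <= P S')%E.
  move=> mS; have mSE c : measurable (S' `&` E c).
    by apply: measurableI => //; exact: measurable_joint_sign.
  have PE c : P (S' `&` E c) = (\int[P]_w (\1_(S' `&` E c) w)%:E)%E.
    by rewrite integral_indic// setIT.
  rewrite (eq_bigr _ (fun c _ => PE c)) -ge0_integral_sum//; last first.
    by move=> c; apply/measurable_EFinP; exact: measurable_indic.
  rewrite -[X in (_ <= P X)%E]setIT -integral_indic//; apply: ge0_le_integral => //.
  - by move=> w _; rewrite sume_ge0.
  - by apply: emeasurable_sum => c; apply/measurable_EFinP; exact: measurable_indic.
  - by apply/measurable_EFinP; exact: measurable_indic.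
  move=> w _; rewrite sumEFin lee_fin.
  have [wS|wS] := boolP (w \in S'); last first.
    rewrite indicE (negbTE wS) big1// => c _; rewrite indicE in_setI.
    by rewrite (negbTE wS).
  rewrite indicE wS.
  have [[c wc]|nc] := pselect (exists c, E c w).
    rewrite (bigD1 c)//= big1 ?addr0; first by rewrite indicE; case: (_ \in _).
    move=> c' c'c; rewrite indicE memNset// => -[_ wc'].
    by move/eqP : c'c; apply; apply: sign_tuple_inj; rewrite -wc' -wc.
  by rewrite big1// => c _; rewrite indicE memNset// => -[_ wc]; apply: nc; exists c.
move=> mS; have mCS : measurable (~` S) by exact: measurableC.
apply/eqP; rewrite eq_le le1// andbT.
have PS : P S = (1 - P (~` S))%E by rewrite -{1}(setCK S) probability_setC.
have hE c : P (E c) = (P (S `&` E c) + P (~` S `&` E c))%E.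
  rewrite [LHS](measureDI P (measurable_joint_sign c) mS) addeC.
  by congr (P _ + P _)%E; apply/seteqP; split => w /= [].
have tot : (\sum_(c : cube) P (E c) = 1)%E.
  rewrite (eq_bigr (fun=> ((2 ^+ n)^-1)%:E)); last by move=> c _; exact: probability_sign_tuple.
  rewrite sumEFin; congr (_%:E).
  rewrite -[RHS](cube_mean_cst (R := R) (n := n) 1) /cube_mean mulr_sumr.
  by apply: eq_bigr => c _; rewrite mulr1.
rewrite PS leeBlDr; last by rewrite fin_num_measure.
rewrite -tot (eq_bigr _ (fun c _ => hE c)) big_split/= leeD2l//.
exact: le1.
Qed.

End RademacherWeights.

Section ConditionalLaw.
Context {d : measure_display} {T : measurableType d} {R : realType}
  (P : probability T R) {n p : nat} (a : p.-tuple R).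
Notation cube := {ffun 'I_n -> bool}.
Notation sample := (n.-tuple (p.-tuple R)).

Definition boot_stat (c : cube) (x : sample) : R :=
  max_stat a (multiplier_sample (sign_tuple c) x).

Definition boot_cdf (x : sample) (q : R) : R :=
  cube_prob [pred c | boot_stat c x <= q].

Hypothesis p0 : (0 < p)%N.

Lemma measurable_entry (i : 'I_n) (j : 'I_p) :
  measurable_fun setT (fun x : sample => tnth (tnth x i) j).
Proof.
apply: (measurableT_comp (f := fun y : p.-tuple R => tnth y j)) => //.
  exact: measurable_tnth.
exact: measurable_tnth.
Qed.

Lemma measurable_max_coord (f : 'I_p -> sample -> R) :
  (forall j, measurable_fun setT (f j)) ->
  measurable_fun setT (fun x => max_coord (fun j => f j x)).
Proof.
move=> mf; case: p p0 f mf => // q _ f mf.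
have -> : (fun x => max_coord (fun j => f j x)) =
   (fun x => \big[Num.max/f ord0 x]_(j < q.+1) f j x).
  by apply/funext => x; rewrite /max_coord /image_mem enum_ordSl.
elim: (index_enum _) => [|j s ih].
  by under eq_fun do rewrite big_nil; exact: mf.
under eq_fun do rewrite big_cons; exact: measurable_maxr.
Qed.

Lemma measurable_max_stat : measurable_fun setT (@max_stat R n p a).
Proof.
apply: (measurable_max_coord (f := fun j x => (Num.sqrt n%:R)^-1 *
  \sum_(i < n) (tnth (tnth x i) j + tnth a j))) => j.
apply: measurable_funM => //; apply: measurable_sum => i.
by apply: measurable_funD => //; exact: measurable_entry.
Qed.

Lemma measurable_sample_fun (g : sample -> sample) :
  (forall i j, measurable_fun setT (fun x => tnth (tnth (g x) i) j)) ->
  measurable_fun setT g.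
Proof.
by move=> mg; apply/measurable_fun_tnthP => i; apply/measurable_fun_tnthP => j; exact: mg.
Qed.

Lemma measurable_sign_flip (c : cube) : measurable_fun setT (@sign_flip R n p c).
Proof.
apply: measurable_sample_fun => i j.
under eq_fun do rewrite tnth_sign_flip.
by apply: measurable_funM => //; exact: measurable_entry.
Qed.

Lemma measurable_sample_mean (j : 'I_p) :
  measurable_fun setT (fun x : sample => sample_mean x j).
Proof.
by apply: measurable_funM => //; apply: measurable_sum => i; exact: measurable_entry.
Qed.

Lemma measurable_boot_stat (c : cube) : measurable_fun setT (boot_stat c).
Proof.
apply: measurableT_comp; first exact: measurable_max_stat.
apply: measurable_sample_fun => i j; under eq_fun do rewrite !tnth_mktuple.
apply: measurable_funM => //; apply: measurable_funB; first exact: measurable_entry.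
exact: measurable_sample_mean.
Qed.

Lemma measurable_boot_stat_le (c : cube) (q : R) : measurable [set x | boot_stat c x <= q].
Proof.
rewrite -[X in measurable X]setTI; apply: measurable_fun_ler => //.
exact: measurable_boot_stat.
Qed.

Lemma boot_cdfE (x : sample) (q : R) :
  boot_cdf x q = \sum_c (2 ^+ n)^-1 * \1_[set x | boot_stat c x <= q] x.
Proof.
rewrite /boot_cdf /cube_prob /cube_mean mulr_sumr; apply: eq_bigr => c _ /=.
rewrite indicE; congr (_ * (nat_of_bool _)%:R).
by apply/idP/idP; rewrite inE.
Qed.

Lemma measurable_boot_cdf (q : R) : measurable_fun setT (boot_cdf ^~ q).
Proof.
under eq_fun do rewrite boot_cdfE.
apply: measurable_sum => c; apply: measurable_funM => //; apply: measurable_indic.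
exact: measurable_boot_stat_le.
Qed.

Section conditional.
Variables (X : 'I_n -> T -> p.-tuple R) (e : 'I_n -> T -> R).
Hypothesis mX : forall i, measurable_fun setT (X i).
Hypothesis me : forall i, measurable_fun setT (e i).
Hypothesis indep_e : mutually_independent P e.
Hypothesis rad_e : forall i, rademacher P (e i).
Hypothesis indep_eX : independent2 P (joint e) (joint X).
Variable k : R.-pker sample ~> R.
Let Tstar w := max_stat a (multiplier_sample (joint e w) (joint X w)).
Hypothesis condk : conditional_distribution P Tstar (joint X) k.

Let mjX := measurable_joint mX.
Let jX : {mfun T >-> sample} := HB.pack (joint X) (isMeasurableFun.Build _ _ _ _ _ mjX).
Let mu := distribution P jX.

(** Independence of weights and data turns the joint probability defining the
conditional law into an average over the [2 ^ n] sign vectors. *)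
Lemma kernel_boot_cdf_integral (q : R) (A : set sample) : measurable A ->
  (\int[mu]_(x in A) k x `]-oo, q]%classic = \int[mu]_(x in A) (boot_cdf x q)%:E)%E.
Proof.
move=> mA; pose B : set R := `]-oo, q]%classic.
have mB : measurable B by exact: measurable_itv.
have mT : measurable_fun setT Tstar.
  apply: measurableT_comp; first exact: measurable_max_stat.
  apply/measurable_fun_tnthP => i; apply/measurable_fun_tnthP => j.
  rewrite /comp; under eq_fun do rewrite !tnth_mktuple.
  apply: measurable_funM => //; apply: measurable_funB.
    exact: (measurableT_comp (measurable_tnth j)).
  exact: (measurableT_comp (measurable_sample_mean j) mjX).
have mTB : measurable (joint X @^-1` A `&` Tstar @^-1` B).
  by apply: measurableI; rewrite -[X in measurable X]setTI; [exact: mjX|exact: mT].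
transitivity (P (joint X @^-1` A `&` Tstar @^-1` B)).
  rewrite (condk mA mB) ge0_integral_pushforward//.
  by apply: measurable_funTS; exact: measurable_kernel.
rewrite (probability_sum_sign_tuple me indep_e rad_e mTB).
under [RHS]eq_integral => x _ do rewrite boot_cdfE -sumEFin.
have m1 c : measurable_fun A (fun x => (\1_[set x | boot_stat c x <= q] x : R)%:E).
  by apply/measurable_EFinP; apply: measurable_indic; exact: measurable_boot_stat_le.
rewrite ge0_integral_sum//; last first.
  by move=> c; under eq_fun do rewrite EFinM; exact: measurable_funeM.
apply: eq_bigr => c _.
under [RHS]eq_integral => x _ do rewrite EFinM.
rewrite ge0_integralZl//.
have mbc := measurable_boot_stat_le c q.
rewrite integral_indic//.
rewrite -(probability_sign_tuple indep_e rad_e c).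
have -> : joint X @^-1` A `&` Tstar @^-1` B `&` joint e @^-1` [set sign_tuple c] =
   joint e @^-1` [set sign_tuple c] `&` joint X @^-1` ([set x | boot_stat c x <= q] `&` A).
  apply/seteqP; split => w /=.
    by move=> [[Aw Bw] ew]; split => //; split => //; move: Bw; rewrite /Tstar ew /B /= in_itv.
  by move=> [ew [Bw Aw]]; split => //; split => //; rewrite /Tstar ew /B /= in_itv.
rewrite indep_eX//; last exact: measurableI.
exact: measurable_sign_tuple.
Qed.

Lemma kernel_boot_cdf_ae : {ae mu, forall x,
  forall i, k x `]-oo, nth_rat i]%classic = (boot_cdf x (nth_rat i))%:E}.
Proof.
apply/ae_foralln => i.
have mcdf : measurable_fun setT (fun x => (boot_cdf x (nth_rat i))%:E).
  by apply/measurable_EFinP; exact: measurable_boot_cdf.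
have icdf : mu.-integrable setT (fun x => (boot_cdf x (nth_rat i))%:E).
  apply: (@le_integrable _ _ _ mu setT measurableT _ (cst 1%E)) => //.
    move=> x _; rewrite /= lee_fin normr1 ger0_norm; first exact: cube_prob_le1.
    exact: cube_prob_ge0.
  exact: finite_measure_integrable_cst.
have := @integral_ae_eq _ _ _ mu setT measurableT
  (fun x => k x `]-oo, nth_rat i]%classic) _ icdf.
move=> /(_ _)[].
- by apply: measurable_kernel; exact: measurable_itv.
- by move=> A _ mA; rewrite kernel_boot_cdf_integral.
move=> N [mN N0 sub]; exists N; split => //.
by apply: subset_trans sub => x /= h h'; apply: h; rewrite h'.
Qed.

(** The samples whose statistic exceeds the [g]-quantile of the bootstrap
distribution, by [quantile_lt]. *)
Definition exceed (g : R) : set sample :=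
  [set x | exists i, g <= boot_cdf x (nth_rat i) /\ nth_rat i < max_stat a x].

Lemma measurable_exceed_gen (g : R) (F : nat -> sample -> \bar R) :
  (forall i, measurable_fun setT (F i)) ->
  measurable [set x | exists i, (g%:E <= F i x)%E /\ nth_rat i < max_stat a x].
Proof.
move=> mF.
have -> : [set x | exists i, (g%:E <= F i x)%E /\ nth_rat i < max_stat a x] =
    \bigcup_i ([set x | (g%:E <= F i x)%E] `&` [set x | nth_rat i < max_stat a x]).
  by apply/seteqP; split => x /= [i]; [move=> [h1 h2]; exists i|move=> _ [h1 h2]; exists i].
apply: bigcupT_measurable => i; apply: measurableI.
  by rewrite -[X in measurable X]setTI; exact: emeasurable_fun_c_infty.
rewrite -[X in measurable X]setTI; apply: measurable_fun_ltr => //.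
exact: measurable_max_stat.
Qed.

Lemma measurable_exceed (g : R) : measurable (exceed g).
Proof.
apply: (@measurable_exceed_gen g (fun i x => (boot_cdf x (nth_rat i))%:E)) => i.
by apply/measurable_EFinP; exact: measurable_boot_cdf.
Qed.

(** The kernel and the bootstrap distribution agree almost surely at every
rational, hence the two events differ by a null set. *)
Lemma probability_quantile_lt (g : R) : 0 < g -> g < 1 ->
  P [set w | quantile (k (joint X w)) g < max_stat a (joint X w)] =
  P (joint X @^-1` exceed g).
Proof.
move=> g0 g1.
pose E := [set x | exists i, (g%:E <= k x `]-oo, nth_rat i]%classic)%E /\
  nth_rat i < max_stat a x].
have mE : measurable E.
  apply: (@measurable_exceed_gen g (fun i x => k x `]-oo, nth_rat i]%classic)) => i.
  by apply: measurable_kernel; exact: measurable_itv.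
have -> : [set w | quantile (k (joint X w)) g < max_stat a (joint X w)] =
    joint X @^-1` E.
  apply/seteqP; split => w /=.
    by move=> h; apply/quantile_lt => //; exact: prob_kernel.
  by move=> h; apply/quantile_lt => //; exact: prob_kernel.
change (mu E = mu (exceed g)).
have mex := measurable_exceed g.
have muE A : measurable A -> mu A = (\int[mu]_x (\1_A x)%:E)%E.
  by move=> mA; rewrite integral_indic// setIT.
rewrite !muE//.
apply: ge0_ae_eq_integral => //.
- by apply/measurable_EFinP; exact: measurable_indic.
- by apply/measurable_EFinP; exact: measurable_indic.
have [N [mN N0 sub]] := kernel_boot_cdf_ae.
exists N; split => // x /= /not_implyP[_ h]; apply: sub => /= hx; apply: h.
congr (_%:E); rewrite !indicE; congr (nat_of_bool _)%:R.
apply/idP/idP; rewrite !inE /E /exceed /= => -[i [h1 h2]]; exists i; split => //.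
  by rewrite -lee_fin -hx.
by rewrite hx lee_fin.
Qed.

End conditional.

End ConditionalLaw.

(** * The randomization argument *)

Section Deterministic.
Context {R : realType} {n p : nat} (a : p.-tuple R).
Notation cube := {ffun 'I_n -> bool}.
Notation sample := (n.-tuple (p.-tuple R)).
Implicit Types (x : sample) (c : cube).

(** Invariant under sign changes, in contrast with [centred] below; it ensures
anti-concentration of the randomization values. *)
Definition regular (K s : R) : set sample := [set x |
  (forall i j, `|tnth (tnth x i) j| <= K) /\
  (forall j, n%:R * s ^+ 2 <= \sum_i tnth (tnth x i) j ^+ 2)].

Definition centred (r : R) : set sample := [set x |
  forall j, `|sample_mean x j| <= r].

Lemma sign_flipK c : involutive (@sign_flip R n p c).
Proof.
move=> x; apply: eq_from_tnth => i; apply: eq_from_tnth => j.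
by rewrite !tnth_sign_flip mulrA sgn_sqr mul1r.
Qed.

Lemma regular_sign_flip K s c x : regular K s x -> regular K s (sign_flip c x).
Proof.
move=> [h1 h2]; split=> [i j|j].
  by rewrite tnth_sign_flip normrM normr_sgn mul1r.
under eq_bigr do rewrite tnth_sign_flip exprMn expr2 sgn_sqr mul1r.
exact: h2.
Qed.

Hypotheses (n0 : (0 < n)%N) (p0 : (0 < p)%N).

Let sqrtn_gt0 : 0 < Num.sqrt n%:R :> R.
Proof. by rewrite sqrtr_gt0 ltr0n. Qed.

Lemma sign_sum_tail (L : R) : 0 <= L ->
  cube_prob (predC [pred c : cube |
    `|\sum_(i < n) (Num.sqrt n%:R)^-1 * sgn c i| <= 4 * Num.sqrt L])
  <= 2 * expR (- (2 * L)).
Proof.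
move=> L0; have sL := sqrtr_ge0 L.
have cV (t : R) : t ^+ 2 = 1 -> \sum_(i < n) (t * (Num.sqrt n%:R)^-1) ^+ 2 <= 1.
  move=> t1; under eq_bigr do rewrite exprMn t1 mul1r exprVn sqr_sqrtr//.
  by rewrite sumr_const card_ord -[_ *+ n]mulr_natr mulVf// pnatr_eq0 -lt0n.
have s0 : 0 <= 4 * Num.sqrt L by rewrite mulr_ge0.
have tail (t : R) : t ^+ 2 = 1 -> cube_prob [pred c : cube |
    4 * Num.sqrt L < \sum_i (t * (Num.sqrt n%:R)^-1) * sgn c i] <= expR (- (2 * L)).
  move=> t1; apply: (le_trans (cube_prob_sum_gt s0 ltr01 (cV t t1))).
  rewrite ler_expR lerN2 exprMn sqr_sqrtr//; lra.
have -> : 2 * expR (- (2 * L)) = expR (- (2 * L)) + expR (- (2 * L)) by lra.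
apply: le_trans (lerD (tail 1 (expr1n _ _)) (tail (-1) (sqrr_sign R 1))).
apply: le_trans (cube_probU _ _); apply: le_cube_prob => c /=.
rewrite -ltNge; under [X in _ -> _ || (_ < X)]eq_bigr do rewrite mulN1r mulNr.
under [X in _ -> (_ < X) || _]eq_bigr do rewrite mul1r.
by rewrite sumrN ltr_normr.
Qed.

(** The rows are normalized by [sqrt n], so a bound [K] on the entries gives
coefficients of size [K / sqrt n]. *)
Lemma regular_anti_concentration (K s L d t : R) x : 0 < K -> 0 < s -> 0 <= d ->
  1 <= L -> 2 * p%:R <= expR L -> regular K s x ->
  cube_prob [pred c | t <= max_stat a (sign_flip c x) <= t + d] <=
    32 * (d + 2 * (K / Num.sqrt n%:R)) / s * Num.sqrt L +
    p%:R * expR (- (n%:R * s ^+ 2 / (32 * K ^+ 2))).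
Proof.
move=> K0 s0 d0 L1 pL [xK xs].
have om0 : 0 < K / Num.sqrt n%:R by rewrite divr_gt0.
have wom j i : `|rademacher_row x j i| <= K / Num.sqrt n%:R.
  by rewrite /rademacher_row normrM gtr0_norm ?invr_gt0// mulrC ler_wpM2r// invr_ge0 ltW.
have sw j : s ^+ 2 <= \sum_i rademacher_row x j i ^+ 2.
  under eq_bigr do rewrite exprMn exprVn sqr_sqrtr//.
  by rewrite -mulr_sumr mulrC ler_pdivlMr ?ltr0n// mulrC.
have IL : 2 * #|'I_p|%:R <= expR L by rewrite card_ord.
pose M c := max_stat a (sign_flip c x).
have ME c : M c = max_coord (fun j => affine_form (rademacher_row x) (@shift R n p a) j c).
  exact: max_stat_sign_flip.
have Mex c : exists j, M c = affine_form (rademacher_row x) (@shift R n p a) j c.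
  by rewrite ME; case: (max_coord_max (fun j => affine_form (rademacher_row x)
    (@shift R n p a) j c) p0).
have Mmax c j : affine_form (rademacher_row x) (@shift R n p a) j c <= M c.
  by rewrite ME; case: (max_coord_max (fun j => affine_form (rademacher_row x)
    (@shift R n p a) j c) p0).
have := max_anti_concentration om0 s0 d0 wom L1 IL t Mex Mmax sw.
rewrite card_ord.
have -> : s ^+ 2 / (32 * (K / Num.sqrt n%:R) ^+ 2) = n%:R * s ^+ 2 / (32 * K ^+ 2).
  rewrite exprMn exprVn sqr_sqrtr//; field.
  by rewrite gt_eqF//= pnatr_eq0 -lt0n.
by [].
Qed.

Section rank.
Variables (K s r L rho g : R).
Hypotheses (L0 : 0 < L) (r0 : 0 < r) (g0 : 0 < g) (g1 : g < 1) (rho0 : 0 <= rho).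
Let d := 4 * Num.sqrt L * r.
Let eta := 2 * expR (- (2 * L)).
Hypothesis rhoP : forall x, regular K s x -> forall t,
  cube_prob [pred c | t <= max_stat a (sign_flip c x) <= t + 2 * d] <= rho.

Let close : pred cube := [pred c : cube |
    `|\sum_(i < n) (Num.sqrt n%:R)^-1 * sgn c i| <= 4 * Num.sqrt L].

Let closeP x : centred r x -> forall c, close c ->
  `|boot_stat a c x - max_stat a (sign_flip c x)| <= d.
Proof.
by move=> xr c cl; apply: max_stat_multiplier_dist.
Qed.

Let close_eta : cube_prob (predC close) <= eta.
Proof. exact/sign_sum_tail/ltW. Qed.

Let eta_ge0 : 0 <= eta.
Proof. by rewrite mulr_ge0// expR_ge0. Qed.

Let rank_sign_flip x c (A : rel R) :
  cube_prob [pred c' | A (max_stat a (sign_flip c' (sign_flip c x)))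
    (max_stat a (sign_flip c x))] =
  cube_prob [pred c' | A (max_stat a (sign_flip c' x)) (max_stat a (sign_flip c x))] :> R.
Proof.
exact: (cube_prob_sign_flip [pred y | A (max_stat a y) (max_stat a (sign_flip c x))]).
Qed.

Let not_regular_flip x (A B : set sample) : ~ regular K s x ->
  [pred c | sign_flip c x \in A `&` (regular K s `&` B)] =1 pred0.
Proof.
move=> nrx c /=; apply/negbTE/negP; rewrite inE => -[_ [rx _]]; apply: nrx.
by rewrite -(sign_flipK c x); exact: regular_sign_flip.
Qed.

(** If a sign change of [x] belongs to the event, its statistic has a high rank
among the values on the orbit of [x], and few sign changes do. *)
Lemma cube_prob_exceed x :
  cube_prob [pred c | sign_flip c x \in exceed a g `&` (regular K s `&` centred r)] <=
    1 - g + eta + rho.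
Proof.
have [rx|nrx] := pselect (regular K s x); last first.
  rewrite cube_prob_eq0; first by have := eta_ge0; have := rho0; have := g1; lra.
  exact: not_regular_flip.
have -> : 1 - g + eta + rho = 1 - (g - eta - rho) by lra.
apply: le_trans (cube_prob_rank_ge (fun c => max_stat a (sign_flip c x)) _); last first.
  have := eta_ge0; have := rho0; have := g1; lra.
apply: le_cube_prob => c /=; rewrite inE => -[[i [gi iy]] [ry cy]].
have := rank_ge_of_quantile_lt (closeP cy) close_eta (rhoP ry) iy gi.
by rewrite (rank_sign_flip x c <%R).
Qed.

(** The mirror image of [cube_prob_exceed]; a rational threshold is taken
within distance [d] below the statistic. *)
Lemma cube_prob_not_exceed x :
  cube_prob [pred c | sign_flip c x \in ~` exceed a g `&` (regular K s `&` centred r)] <=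
    g + eta + rho.
Proof.
have [rx|nrx] := pselect (regular K s x); last first.
  rewrite cube_prob_eq0; first by have := eta_ge0; have := rho0; have := g0; lra.
  exact: not_regular_flip.
apply: le_trans (cube_prob_rank_le (fun c => max_stat a (sign_flip c x)) _); last first.
  have := eta_ge0; have := rho0; have := g0; lra.
apply: le_cube_prob => c /=; rewrite inE => -[nex [ry cy]].
have d0 : 0 < d by rewrite mulr_gt0// mulr_gt0// sqrtr_gt0.
have [i /andP[i1 i2]] : exists i, max_stat a (sign_flip c x) - d < nth_rat i <
    max_stat a (sign_flip c x) by apply: nth_rat_dense; rewrite ltrBlDr ltrDl.
have gi : boot_cdf a (sign_flip c x) (nth_rat i) <= g.
  by rewrite leNgt; apply/negP => /ltW gi; apply: nex; exists i.
have := rank_le_of_quantile_ge (closeP cy) close_eta (rhoP ry) (ltW i1) gi.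
by rewrite (rank_sign_flip x c <=%R).
Qed.

End rank.
End Deterministic.

Section Randomization.
Context {d : measure_display} {T : measurableType d} {R : realType}
  (P : probability T R) {n p : nat} (a : p.-tuple R).
Notation cube := {ffun 'I_n -> bool}.
Notation sample := (n.-tuple (p.-tuple R)).
Hypotheses (n0 : (0 < n)%N) (p0 : (0 < p)%N).
Variable X : 'I_n -> T -> p.-tuple R.
Hypothesis mX : forall i, measurable_fun setT (X i).
Hypothesis indepX : mutually_independent P X.
Hypothesis symX : forall i, identically_distributed P (X i) (fun w => oppt (X i w)).

Let flip_row (b : bool) (y : p.-tuple R) : p.-tuple R := if b then oppt y else y.

Let measurable_oppt : measurable_fun setT (@oppt R p).
Proof.
apply/measurable_fun_tnthP => j; rewrite /comp; under eq_fun do rewrite tnth_mktuple.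
by apply: measurableT_comp => //; exact: measurable_tnth.
Qed.

Let measurable_flip_row b : measurable_fun setT (flip_row b).
Proof. by case: b; [exact: measurable_oppt|exact: measurable_id]. Qed.

Let joint_flip_row (c : cube) (w : T) :
  joint (fun i w => flip_row (c i) (X i w)) w = sign_flip c (joint X w).
Proof.
apply: eq_from_tnth => i; apply: eq_from_tnth => j.
rewrite tnth_sign_flip !tnth_mktuple /flip_row /sgn; case: (c i).
  by rewrite tnth_mktuple expr1 mulN1r.
by rewrite expr0 mul1r.
Qed.

(** The rows with changed signs are still independent and keep their laws. *)
Lemma sign_flip_invariance (c : cube) (A : set sample) : measurable A ->
  P (joint X @^-1` (sign_flip c @^-1` A)) = P (joint X @^-1` A).
Proof.
move=> mA; pose Y i w := flip_row (c i) (X i w).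
have mY i : measurable_fun setT (Y i) by exact: measurableT_comp.
have -> : joint X @^-1` (sign_flip c @^-1` A) = joint Y @^-1` A.
  by apply/seteqP; split => w /=; rewrite joint_flip_row.
apply/esym/eq_joint_law => //.
  move=> J B mB.
  have mB' i : measurable (flip_row (c i) @^-1` B i).
    by rewrite -[X in measurable X]setTI; exact: measurable_flip_row.
  exact: (indepX J mB').
move=> i B mB; rewrite /Y /flip_row; case: (c i) => //.
exact: symX.
Qed.

(** By invariance the probability of [H] is the mean over the signs of the
probability that the changed sample is in [H]; exchanging the two means leaves a
pointwise bound on each orbit. *)
Lemma probability_le_of_sign_flips (H : set sample) (q : R) : measurable H ->
  (forall x, cube_prob [pred c | sign_flip c x \in H] <= q) ->
  (P (joint X @^-1` H) <= q%:E)%E.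
Proof.
move=> mH Hq; have mjX := measurable_joint mX.
have mjH (A : set sample) : measurable A -> measurable (joint X @^-1` A).
  by move=> mA; rewrite -[X in measurable X]setTI; exact: mjX.
have mcH c : measurable (sign_flip c @^-1` H).
  by rewrite -[X in measurable X]setTI; exact: measurable_sign_flip.
pose q0 := fine (P (joint X @^-1` H)).
have PH : P (joint X @^-1` H) = q0%:E by rewrite fineK// fin_num_measure//; exact: mjH.
have PHc c : (\int[P]_w (\1_(joint X @^-1` (sign_flip c @^-1` H)) w)%:E = q0%:E)%E.
  rewrite integral_indic//; last exact: mjH.
  by rewrite setIT -PH; exact: sign_flip_invariance.
have -> : P (joint X @^-1` H) = (\sum_(c : cube) (2 ^- n)%:E *
    \int[P]_w (\1_(joint X @^-1` (sign_flip c @^-1` H)) w)%:E)%E.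
  rewrite PH (eq_bigr (fun=> (2 ^- n * q0)%:E)); last first.
    by move=> c _; rewrite PHc EFinM.
  by rewrite sumEFin -mulr_sumr; congr (_%:E); rewrite -[LHS](cube_mean_cst (R := R) (n := n)).
have m1 c : measurable_fun setT (fun w => (\1_(joint X @^-1` (sign_flip c @^-1` H)) w : R)%:E).
  by apply/measurable_EFinP; apply: measurable_indic; exact: mjH.
under eq_bigr => c _ do rewrite -ge0_integralZl//.
rewrite -ge0_integral_sum//; last by move=> c; exact: measurable_funeM.
rewrite -[q%:E]mule1 -(probability_setT P) -integral_cst//.
apply: ge0_le_integral => //.
- by move=> w _; apply: sume_ge0 => c _; rewrite mule_ge0// lee_fin.
- by apply: emeasurable_sum => c; exact: measurable_funeM.
move=> w _; under eq_bigr do rewrite -EFinM.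
rewrite sumEFin lee_fin -mulr_sumr; apply: le_trans (Hq (joint X w)).
rewrite le_eqVlt; apply/orP; left; apply/eqP.
by congr (_ * _).
Qed.

Lemma measurable_regular (K s : R) : measurable (@regular R n p K s).
Proof.
have -> : @regular R n p K s =
  (\bigcap_(i in [set: 'I_n]) \bigcap_(j in [set: 'I_p])
     [set x | `|tnth (tnth x i) j| <= K]) `&`
  (\bigcap_(j in [set: 'I_p])
     [set x | n%:R * s ^+ 2 <= \sum_i tnth (tnth x i) j ^+ 2]).
  apply/seteqP; split=> [x [h1 h2]|x [h1 h2]].
    by split => [i _ j _|j _]; [exact: h1|exact: h2].
  by split => [i j|j]; [exact: h1|exact: h2].
apply: measurableI.
  apply: fin_bigcap_measurable => // i _; apply: fin_bigcap_measurable => // j _.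
  rewrite -[X in measurable X]setTI; apply: measurable_fun_ler => //.
  by apply: measurableT_comp => //; exact: measurable_entry.
apply: fin_bigcap_measurable => // j _.
rewrite -[X in measurable X]setTI; apply: measurable_fun_ler => //.
by apply: measurable_sum => i; apply: measurable_funX; exact: measurable_entry.
Qed.

Lemma measurable_centred (r : R) : measurable (@centred R n p r).
Proof.
have -> : @centred R n p r =
  \bigcap_(j in [set: 'I_p]) [set x | `|sample_mean x j| <= r].
  by apply/seteqP; split=> [x h j _|x h j]; exact: h.
apply: fin_bigcap_measurable => // j _.
rewrite -[X in measurable X]setTI; apply: measurable_fun_ler => //.
by apply: measurableT_comp => //; exact: measurable_sample_mean.
Qed.

(** The two one-sided bounds apply to the event and to its complement. *)
Lemma randomization_error (K s r L rho g bad : R) :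
  0 < L -> 0 < r -> 0 < g -> g < 1 -> 0 <= rho ->
  (forall x, regular K s x -> forall t, cube_prob [pred c |
     t <= max_stat a (@sign_flip R n p c x) <= t + 2 * (4 * Num.sqrt L * r)] <= rho) ->
  (P (joint X @^-1` (~` (regular K s `&` centred r))) <= bad%:E)%E ->
  (`|P (joint X @^-1` exceed a g) - (1 - g)%:E| <=
    (2 * expR (- (2 * L)) + rho + bad)%:E)%E.
Proof.
move=> L0 r0 g0 g1 rho0 rhoP badP; have mjX := measurable_joint mX.
have mjH (A : set sample) : measurable A -> measurable (joint X @^-1` A).
  by move=> mA; rewrite -[X in measurable X]setTI; exact: mjX.
pose G := @regular R n p K s `&` centred r.
have mG : measurable G.
  by apply: measurableI; [exact: measurable_regular|exact: measurable_centred].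
have mE : measurable (exceed a g : set sample) by exact: measurable_exceed.
pose pr (A : set sample) := fine (P (joint X @^-1` A)).
have prE A : measurable A -> P (joint X @^-1` A) = (pr A)%:E.
  by move=> mA; rewrite /pr fineK// fin_num_measure//; exact: mjH.
have split_le A : measurable A -> pr A <= pr (A `&` G) + bad.
  move=> mA; have mAG : measurable (A `&` G) by exact: measurableI.
  have mCG : measurable (~` G) by exact: measurableC.
  rewrite -lee_fin EFinD -!prE//.
  apply: (@le_trans _ _ (P (joint X @^-1` (A `&` G)) + P (joint X @^-1` (~` G)))%E).
    apply: le_trans (measureU2 _ (mjH _ mAG) (mjH _ mCG)).
    apply: le_measure; rewrite ?inE; [exact: mjH|by apply: measurableU; exact: mjH|].
    by move=> w Aw; have [Gw|Gw] := pselect (G (joint X w)); [left|right].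
  by rewrite leeD2l.
have up : pr (exceed a g `&` G) <= 1 - g + 2 * expR (- (2 * L)) + rho.
  rewrite -lee_fin -prE; last exact: measurableI.
  apply: probability_le_of_sign_flips; first exact: measurableI.
  by move=> x; exact: (cube_prob_exceed n0 p0 L0 g1 rho0 rhoP).
have down : pr (~` exceed a g `&` G) <= g + 2 * expR (- (2 * L)) + rho.
  have mCE : measurable (~` exceed a g : set sample) by exact: measurableC.
  rewrite -lee_fin -prE; last exact: measurableI.
  apply: probability_le_of_sign_flips; first exact: measurableI.
  by move=> x; exact: (cube_prob_not_exceed n0 p0 L0 r0 g0 rho0 rhoP).
have compl : pr (~` exceed a g) = 1 - pr (exceed a g).
  apply: EFin_inj; rewrite EFinB -!prE//; last exact: measurableC.
  by rewrite -probability_setC//; exact: mjH.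
have := split_le _ mE; have := split_le _ (measurableC mE).
rewrite prE// compl => h1 h2.
by rewrite -EFinB /= lee_fin ler_norml; apply/andP; split; lra.
Qed.

End Randomization.

(** * Tail bounds for the data *)

Lemma probability_union_bound d (T : measurableType d) (R : realType)
    (P : probability T R) (I : finType) (F : I -> set T) (c : I -> R) (A : set T) :
  measurable A -> (forall i, measurable (F i)) ->
  (forall w, A w -> exists i, F i w) -> (forall i, (P (F i) <= (c i)%:E)%E) ->
  (P A <= (\sum_i c i)%:E)%E.
Proof.
move=> mA mF AF Fc.
rewrite -[X in P X]setIT -integral_indic//.
apply: (@le_trans _ _ (\int[P]_w (\sum_i (\1_(F i) w)%:E))%E).
  apply: ge0_le_integral => //.
  - by apply/measurable_EFinP; exact: measurable_indic.
  - by apply: emeasurable_sum => i; apply/measurable_EFinP; exact: measurable_indic.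
  move=> w _; rewrite sumEFin lee_fin.
  have [wA|wA] := boolP (w \in A).
    have [i Fi] : exists i, F i w by apply: AF; move: wA; rewrite inE.
    rewrite (bigD1 i)//= !indicE wA mem_set// lerDl sumr_ge0//.
  by rewrite indicE (negbTE wA) sumr_ge0.
rewrite ge0_integral_sum//; last first.
  by move=> i; apply/measurable_EFinP; exact: measurable_indic.
rewrite -sumEFin; apply: lee_sum => i _; rewrite integral_indic// setIT.
exact: Fc.
Qed.

Section Tails.
Context {d : measure_display} {T : measurableType d} {R : realType}
  (P : probability T R) {n p : nat}.
Variable X : 'I_n -> T -> p.-tuple R.
Hypothesis mX : forall i, measurable_fun setT (X i).
Hypothesis indepX : mutually_independent P X.

Let mXj i j : measurable_fun setT (fun w => tnth (X i w) j).
Proof. exact: (measurableT_comp (measurable_tnth j) (mX i)). Qed.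

(** The Chernoff exponent [2 * l ^+ 2 * n * v - (3 / 4) * l * n * m] is evaluated at
[l = m / (4 * v)]. *)
Lemma second_moment_lower_tail (j : 'I_p) (m v : R) : (0 < n)%N -> 0 < m -> 0 < v ->
  (m%:E <= n%:R^-1%:E * \sum_(i < n) 'E_P[fun w => (tnth (X i w) j ^+ 2)%R])%E ->
  (n%:R^-1%:E * \sum_(i < n) 'E_P[fun w => (tnth (X i w) j ^+ 4)%R] <= v%:E)%E ->
  (P [set w | \sum_i tnth (X i w) j ^+ 2 < n%:R * (m / 4)]%R <=
    (expR (- (n%:R * m ^+ 2 / (16 * v))))%:E)%E.
Proof.
move=> n0 m0 v0 hm hv; have nR0 : (0 : R) < n%:R by rewrite ltr0n.
pose Y i w := tnth (X i w) j.
have mY i : measurable_fun setT (Y i) by exact: mXj.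
have Y40 i w : (0 <= Y i w ^+ 4)%R by rewrite -[4%N]/(2 * 2)%N exprM sqr_ge0.
have E4sum : (\sum_(i < n) 'E_P[fun w => (Y i w ^+ 4)%R] <= (n%:R * v)%:E)%E.
  by rewrite EFinM -lee_pdivrMl// EFinV ?gt_eqF.
have E4_fin i : ('E_P[fun w => (Y i w ^+ 4)%R])%E \is a fin_num.
  rewrite ge0_fin_numE ?expectation_ge0//.
  apply: le_lt_trans (ltry (n%:R * v)); apply: le_trans E4sum.
  by rewrite (bigD1 i)//= leeDl// sume_ge0// => k _; exact: expectation_ge0.
have mY2 i : measurable_fun setT (fun w => Y i w ^+ 2) by exact: measurable_funX.
have mY4 i : measurable_fun setT (fun w => Y i w ^+ 4) by exact: measurable_funX.
have E2_fin i : ('E_P[fun w => (Y i w ^+ 2)%R])%E \is a fin_num.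
  rewrite ge0_fin_numE; last by apply: expectation_ge0 => w; exact: sqr_ge0.
  apply: (@le_lt_trans _ _ (1 + 'E_P[fun w => (Y i w ^+ 4)%R])%E); last first.
    by rewrite lte_add_pinfty// ?ltry// -ge0_fin_numE// expectation_ge0.
  have one : (1 = \int[P]_w (1%E : \bar R))%E.
    by rewrite integral_cst//= probability_setT mul1e.
  rewrite unlock [X in (_ <= X + _)%E]one -ge0_integralD//; last 2 first.
  - by move=> w _; rewrite lee_fin.
  - exact/measurable_EFinP.
  apply: ge0_le_integral => //.
  - by move=> w _; rewrite lee_fin sqr_ge0.
  - exact/measurable_EFinP.
  - apply: emeasurable_funD => //; exact/measurable_EFinP.
  move=> w _; rewrite -EFinD lee_fin -[4%N]/(2 * 2)%N exprM.
  have := sqr_ge0 (Y i w ^+ 2 - 1); nra.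
pose a2 i := fine ('E_P[fun w => (Y i w ^+ 2)%R])%E.
pose a4 i := fine ('E_P[fun w => (Y i w ^+ 4)%R])%E.
have a4v : \sum_i a4 i <= n%:R * v.
  by rewrite -lee_fin -sumEFin (eq_bigr _ (fun i _ => fineK (E4_fin i))).
have a2m : n%:R * m <= \sum_i a2 i.
  rewrite -lee_fin -sumEFin (eq_bigr _ (fun i _ => fineK (E2_fin i))).
  by rewrite EFinM -lee_pdivlMl// EFinV ?gt_eqF.
pose l := m / (4 * v).
have l0 : 0 <= l by rewrite divr_ge0 ?mulr_ge0// ltW.
apply: (@le_trans _ _ (P [set w | - (l * (n%:R * (m / 4))) <= \sum_i - (l * Y i w ^+ 2)]%R)).
  apply: le_measure; rewrite ?inE.
  - rewrite -[X in measurable X]setTI; apply: measurable_fun_ltr => //.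
    exact: measurable_sum.
  - rewrite -[X in measurable X]setTI; apply: measurable_fun_ler => //.
    by apply: measurable_sum => i; apply: measurableT_comp => //; exact: measurable_funM.
  move=> w /= h; rewrite sumrN lerN2 -mulr_sumr ler_wpM2l//; exact: ltW.
have mf (i : 'I_n) : measurable_fun setT (fun y : p.-tuple R => - (l * tnth y j ^+ 2)).
  apply: measurableT_comp => //; apply: measurable_funM => //.
  by apply: measurable_funX; exact: measurable_tnth.
have := probability_sum_ge mX indepX (f := fun i y => - (l * tnth y j ^+ 2))
  (c := fun i => 2 * l ^+ 2 * a4 i - l * a2 i) (- (l * (n%:R * (m / 4)))) mf.
move=> tail; apply: (le_trans (tail _)).
  by move=> i; apply: mgf_opp_sqr_le => //; rewrite fineK.
rewrite lee_fin ler_expR sumrB -!mulr_sumr.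
have h1 : 2 * l ^+ 2 * \sum_i a4 i <= 2 * l ^+ 2 * (n%:R * v).
  by rewrite ler_wpM2l// mulr_ge0// sqr_ge0.
have h2 : l * (n%:R * m) <= l * \sum_i a2 i by rewrite ler_wpM2l.
have e1 : 2 * l ^+ 2 * (n%:R * v) = 2 * (n%:R * m ^+ 2 / (16 * v)).
  by rewrite /l; field; rewrite gt_eqF.
have e2 : l * (n%:R * m) = 4 * (n%:R * m ^+ 2 / (16 * v)).
  by rewrite /l; field; rewrite gt_eqF.
have e3 : l * (n%:R * (m / 4)) = n%:R * m ^+ 2 / (16 * v).
  by rewrite /l; field; rewrite gt_eqF.
rewrite e3; lra.
Qed.

Lemma sum_upper_tail (j : 'I_p) (B l s : R) : 0 < B -> `|l| <= (2 * B)^-1 ->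
  (forall i, ('E_P[fun w => tnth (X i w) j] = 0)%E) ->
  (forall i, ('E_P[fun w => expR (`|tnth (X i w) j| / B)%R] <= 2%:E)%E) ->
  (P [set w | s <= l * \sum_i tnth (X i w) j]%R <=
    (expR (128 * n%:R * (l * B) ^+ 2 - s))%:E)%E.
Proof.
move=> B0 lB E0 Eexp.
have mf (i : 'I_n) : measurable_fun setT (fun y : p.-tuple R => l * tnth y j).
  by apply: measurable_funM => //; exact: measurable_tnth.
have := probability_sum_ge mX indepX (f := fun i y => l * tnth y j)
  (c := fun=> 128 * (l * B) ^+ 2) s mf.
move=> tail; under eq_set => w do rewrite mulr_sumr.
apply: (le_trans (tail _)); first by move=> i; apply: mgf_le_of_expR_moment.
by rewrite sumr_const card_ord -[_ *+ n]mulr_natl mulrA [n%:R * _]mulrC.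
Qed.

(** With [l * B = sqrt (L / n) / 2] the Chernoff exponent is [32 * L - 34 * L]; the
assumption [L <= n] keeps [l] in the range of [mgf_le_of_expR_moment]. *)
Lemma sample_mean_tail (j : 'I_p) (B L : R) : 0 < B -> 0 < L -> L <= n%:R ->
  (forall i, ('E_P[fun w => tnth (X i w) j] = 0)%E) ->
  (forall i, ('E_P[fun w => expR (`|tnth (X i w) j| / B)%R] <= 2%:E)%E) ->
  (P [set w | 68 * B * Num.sqrt (L / n%:R) < `|sample_mean (joint X w) j|]%R <=
    (2 * expR (- (2 * L)))%:E)%E.
Proof.
move=> B0 L0 Ln E0 Eexp; have n0 : (0 : R) < n%:R by lra.
pose q := Num.sqrt (L / n%:R); have Ln0 : 0 <= L / n%:R by rewrite divr_ge0 ?ltW.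
have q0 : 0 < q by rewrite sqrtr_gt0 divr_gt0.
have q2 : q ^+ 2 = L / n%:R by rewrite sqr_sqrtr.
have q1 : q <= 1 by rewrite -[leRHS]sqrtr1 ler_wsqrtr// ler_pdivrMr// mul1r.
pose l := q / (2 * B).
have l0 : 0 < l by rewrite divr_gt0// mulr_gt0.
have lB t : t ^+ 2 = 1 -> `|t * l| <= (2 * B)^-1.
  move=> t1; have -> : `|t * l| = l.
    rewrite normrM (gtr0_norm l0) -[RHS]mul1r; congr (_ * _).
    by apply/eqP; rewrite -(@eqrXn2 _ 2)// -normrX t1 normr1 expr1n.
  by rewrite /l ler_piMl// invr_ge0 mulr_ge0// ltW.
pose F (b : bool) := [set w | 34 * L <= ((-1) ^+ b * l) * \sum_i tnth (X i w) j]%R.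
have mF b : measurable (F b).
  rewrite -[X in measurable X]setTI; apply: measurable_fun_ler => //.
  by apply: measurable_funM => //; exact: measurable_sum.
have PF b : (P (F b) <= (expR (- (2 * L)))%:E)%E.
  have t1 : ((-1) ^+ b : R) ^+ 2 = 1 by rewrite sqrr_sign.
  apply: (le_trans (sum_upper_tail (34 * L) B0 (lB _ t1) E0 Eexp)).
  rewrite lee_fin ler_expR exprMn [(_ * l) ^+ 2]exprMn t1 mul1r.
  have -> : 128 * n%:R * (l ^+ 2 * B ^+ 2) = 32 * n%:R * q ^+ 2.
    by rewrite /l; field; rewrite gt_eqF.
  rewrite q2 -mulrA [n%:R * _]mulrC divfK ?gt_eqF//; lra.
have := @probability_union_bound _ _ _ P bool F (fun=> expR (- (2 * L)))
  [set w | 68 * B * q < `|sample_mean (joint X w) j|]%R.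
rewrite big_bool/=.
have -> : expR (- (2 * L)) + expR (- (2 * L)) = 2 * expR (- (2 * L)) by lra.
apply => //.
  rewrite -[X in measurable X]setTI; apply: measurable_fun_ltr => //.
  apply: measurableT_comp => //.
  apply: (measurableT_comp (measurable_sample_mean j)).
  exact: measurable_joint.
move=> w /=.
have -> : sample_mean (joint X w) j = n%:R^-1 * \sum_i tnth (X i w) j.
  by congr (_ * _); apply: eq_bigr => i _; rewrite tnth_mktuple.
set S := \sum_i _ => h.
have hS : 68 * B * q * n%:R < `|S|.
  by move: h; rewrite normrM gtr0_norm ?invr_gt0// [ltRHS]mulrC ltr_pdivlMr.
have hl : 34 * L <= l * `|S|.
  have -> : 34 * L = l * (68 * B * q * n%:R).
    have -> : L = q ^+ 2 * n%:R by rewrite q2 divfK// gt_eqF.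
    by rewrite /l; field; rewrite gt_eqF.
  by rewrite ler_pM2l// ltW.
have [S0|S0] := ger0P S.
  by exists false; rewrite /F /= expr0 mul1r; move: hl; rewrite ger0_norm.
by exists true; rewrite /F /= expr1 mulN1r mulNr -mulrN; move: hl; rewrite ltr0_norm.
Qed.

(** A union bound over [n * p] entries and [p] coordinates, each at probability of
order [expR (- (2 * L))], where [expR L = p * n]. *)
Lemma irregular_probability (B L b1 b2 : R) : (0 < n)%N -> (0 < p)%N ->
  0 < b1 -> 0 < b2 -> 0 < B -> 0 < L -> expR L = (p * n)%:R -> L <= n%:R ->
  32 * L * (B ^+ 2 * b2 ^+ 2) <= n%:R * b1 ^+ 4 ->
  (forall i j, ('E_P[fun w => tnth (X i w) j] = 0)%E) ->
  (forall i j, ('E_P[fun w => expR (`|tnth (X i w) j| / B)%R] <= 2%:E)%E) ->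
  (forall j,
    ((b1 ^+ 2)%:E <=
       n%:R^-1%:E * \sum_(i < n) 'E_P[fun w => (tnth (X i w) j ^+ 2)%R])%E /\
    (n%:R^-1%:E * \sum_(i < n) 'E_P[fun w => (tnth (X i w) j ^+ 4)%R] <=
       (B ^+ 2 * b2 ^+ 2)%:E)%E) ->
  (P (joint X @^-1` (~` (regular (B * (2 * L)) (b1 / 2) `&`
      centred (68 * B * Num.sqrt (L / n%:R))))) <= (5 * expR (- L))%:E)%E.
Proof.
move=> n0 p0 b10 b20 B0 L0 eL Ln small E0 Eexp EM.
have mjX := measurable_joint mX.
have mjH (A : set (n.-tuple (p.-tuple R))) : measurable A -> measurable (joint X @^-1` A).
  by move=> mA; rewrite -[X in measurable X]setTI; exact: mjX.
pose r := 68 * B * Num.sqrt (L / n%:R).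
pose F (k : 'I_n * 'I_p + ('I_p + 'I_p)) : set T := match k with
  | inl ij => [set w | B * (2 * L) < `|tnth (X ij.1 w) ij.2|]
  | inr (inl j) => [set w | \sum_i tnth (X i w) j ^+ 2 < n%:R * (b1 ^+ 2 / 4)]
  | inr (inr j) => [set w | r < `|sample_mean (joint X w) j|]
  end.
pose c (k : 'I_n * 'I_p + ('I_p + 'I_p)) : R := match k with
  | inl ij => 2 * expR (- (2 * L))
  | inr (inl j) => expR (- (2 * L))
  | inr (inr j) => 2 * expR (- (2 * L))
  end.
have eL2 : expR (- (2 * L)) = expR (- L) * expR (- L) by rewrite -expRD; congr expR; lra.
have npL : n%:R * p%:R * expR (- L) = 1 :> R.
  by rewrite -natrM mulnC -eL -expRD subrr expR0.
have nR : (1 : R) <= n%:R by rewrite ler1n.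
have pR : (0 : R) < p%:R by rewrite ltr0n.
have e0 := expR_gt0 (- L).
apply: (@le_trans _ _ (\sum_k c k)%:E); last first.
  have sum_cst (I : finType) (z : R) : \sum_(i : I) z = #|I|%:R * z.
    by rewrite sumr_const mulr_natl.
  rewrite lee_fin big_sumType/= big_sumType/= !sum_cst card_prod !card_ord eL2 natrM.
  set x := expR (- L) in e0 npL *.
  have px1 : p%:R * x <= 1.
    by rewrite -[leRHS]npL -mulrA ler_peMl// mulr_ge0// ltW.
  have -> : n%:R * p%:R * (2 * (x * x)) + (p%:R * (x * x) + p%:R * (2 * (x * x))) =
      2 * x * (n%:R * p%:R * x) + 3 * x * (p%:R * x) by ring.
  have : 3 * x * (p%:R * x) <= 3 * x by rewrite ler_piMr// mulr_ge0// ltW.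
  rewrite npL; lra.
apply: (probability_union_bound (F := F)).
- by apply/mjH/measurableC/measurableI; [exact: measurable_regular|exact: measurable_centred].
- move=> [[i j]|[j|j]] /=; rewrite -[X in measurable X]setTI; apply: measurable_fun_ltr => //.
  + exact: measurableT_comp.
  + by apply: measurable_sum => i; exact: measurable_funX.
  + apply: measurableT_comp => //.
    exact: (measurableT_comp (measurable_sample_mean j)).
- move=> w /= hw; apply: contrapT => /forallNP nF; apply: hw; split; last first.
    by move=> j; rewrite leNgt; apply/negP; exact: (nF (inr (inr j))).
  split=> [i j|j]; rewrite leNgt; apply/negP.
    by rewrite tnth_mktuple; exact: (nF (inl (i, j))).
  under eq_bigr do rewrite tnth_mktuple.
  have -> : n%:R * (b1 / 2) ^+ 2 = n%:R * (b1 ^+ 2 / 4) by field.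
  exact: (nF (inr (inl j))).
move=> [[i j]|[j|j]] /=.
- exact: probability_norm_gt.
- have [h1 h2] := EM j.
  have b120 : 0 < b1 ^+ 2 by rewrite exprn_gt0.
  have v0 : 0 < B ^+ 2 * b2 ^+ 2 by rewrite mulr_gt0// exprn_gt0.
  apply: (le_trans (second_moment_lower_tail n0 b120 v0 h1 h2)).
  rewrite lee_fin ler_expR lerN2 ler_pdivlMr ?mulr_gt0//.
  rewrite -exprM; lra.
- exact: sample_mean_tail.
Qed.

End Tails.

(** * The rate *)

Lemma ln_natM_ge1 (R : realType) (n p : nat) : (3 <= n)%N -> (2 <= p)%N ->
  1 <= ln (p * n)%:R :> R.
Proof.
move=> n3 p2; have pn : (4 <= p * n)%N by rewrite (leq_trans _ (leq_mul p2 n3)).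
have pn0 : (0 : R) < (p * n)%:R by rewrite ltr0n (leq_trans _ pn).
rewrite -ler_expR lnK ?posrE//.
apply: (@le_trans _ _ 4%:R); last by rewrite ler_nat.
have h : expR (2^-1 : R) <= 2.
  by have := @expR_le_quad R 2^-1 (lexx _); lra.
have -> : expR (1 : R) = expR 2^-1 * expR 2^-1 by rewrite -expRD; congr expR; lra.
have := expR_gt0 (2^-1 : R); nra.
Qed.

Section Rate.
Context {R : realType}.
Variables (n p : nat) (B b1 b2 : R).
Hypotheses (n3 : (3 <= n)%N) (p2 : (2 <= p)%N) (B1 : 1 <= B).
Hypotheses (b10 : 0 < b1) (b20 : 0 < b2).

Let L : R := ln (p * n)%:R.
Let N : R := n%:R.
Let rate : R := Num.sqrt (B ^+ 2 * L ^+ 3 / N).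
Let u1 : R := 32 * b2 ^+ 2 / b1 ^+ 4.
Let u2 : R := 32 * 32 / b1 ^+ 2.
(** The bound is at least 1 unless [c1 * B ^+ 2 * L ^+ 3 <= n]; the summands of
[c1] serve the lower tail of the second moments, the balance of the
randomization values, and [L <= n]. *)
Let c1 : R := u1 + u2 + 1.

Let u1_ge0 : 0 <= u1.
Proof. by rewrite divr_ge0 ?mulr_ge0 ?exprn_ge0 ?ltW. Qed.
Let u2_ge0 : 0 <= u2.
Proof. by rewrite divr_ge0 ?mulr_ge0 ?exprn_ge0 ?ltW. Qed.
Let c1_ge1 : 1 <= c1.
Proof. by have := u1_ge0; have := u2_ge0; rewrite /c1; lra. Qed.

Let L1 : 1 <= L. Proof. exact: ln_natM_ge1. Qed.
Let N1 : 1 <= N. Proof. by rewrite ler1n (leq_trans _ n3). Qed.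
Let B0 : 0 < B. Proof. exact: lt_le_trans B1. Qed.
Let L0 : 0 < L. Proof. exact: lt_le_trans L1. Qed.
Let N0 : 0 < N. Proof. exact: lt_le_trans N1. Qed.

Let pn0 : (0 : R) < (p * n)%:R.
Proof. by rewrite ltr0n muln_gt0 (leq_trans _ p2) ?(leq_trans _ n3). Qed.

Let expL : expR L = (p * n)%:R. Proof. by rewrite lnK. Qed.

Let rate2 : rate ^+ 2 = B ^+ 2 * L ^+ 3 / N.
Proof. by rewrite sqr_sqrtr// divr_ge0 ?mulr_ge0 ?exprn_ge0 ?ltW. Qed.

Let rate0 : 0 <= rate. Proof. exact: sqrtr_ge0. Qed.

Let rateE : rate = B * L * Num.sqrt L / Num.sqrt N.
Proof.
rewrite /rate; have -> : B ^+ 2 * L ^+ 3 / N = (B * L) ^+ 2 * L / N by field; rewrite gt_eqF.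
rewrite sqrtrM ?mulr_ge0 ?sqr_ge0 ?ltW// sqrtrM ?sqr_ge0// sqrtr_sqr sqrtrV ?ltW//.
by rewrite gtr0_norm// mulr_gt0.
Qed.

Let expNL_le_rate : expR (- L) <= rate.
Proof.
have sN : 1 <= Num.sqrt N by rewrite -[leLHS]sqrtr1 ler_wsqrtr.
have sL : 1 <= Num.sqrt L by rewrite -[leLHS]sqrtr1 ler_wsqrtr.
have NE : N = Num.sqrt N * Num.sqrt N by rewrite -expr2 sqr_sqrtr// ltW.
apply: (@le_trans _ _ N^-1).
  rewrite expRN expL lef_pV2 ?posrE// ler_nat leq_pmull// (leq_trans _ p2)//.
apply: (@le_trans _ _ (Num.sqrt N)^-1).
  by rewrite lef_pV2 ?posrE//; [rewrite [leRHS]NE; nra|lra].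
rewrite rateE -[leLHS]mul1r ler_wpM2r// ?invr_ge0//.
have : 1 <= B * L by have := B1; have := L1; nra.
nra.
Qed.

Lemma one_le_rate : N < c1 * (B ^+ 2 * L ^+ 3) -> 1 <= c1 * rate.
Proof.
move=> big; have c11 := c1_ge1.
have h : 1 < c1 * rate ^+ 2 by rewrite rate2 mulrA ltr_pdivlMr// mul1r.
have cr0 : 0 <= c1 * rate by rewrite mulr_ge0//; lra.
rewrite -(@ler_pXn2r _ 2) ?nnegrE// expr1n exprMn.
have : 0 <= rate ^+ 2 by exact: sqr_ge0.
nra.
Qed.

Section small.
Hypothesis small : c1 * (B ^+ 2 * L ^+ 3) <= N.
Let Q := B ^+ 2 * L ^+ 3.
Let Q0 : 0 < Q. Proof. by rewrite mulr_gt0 ?exprn_gt0. Qed.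

Let cond u : u <= c1 -> u * Q <= N.
Proof. by move=> uc; apply: le_trans small; rewrite ler_pM2r. Qed.

Let cond1 : 32 * b2 ^+ 2 * Q <= N * b1 ^+ 4.
Proof.
rewrite -ler_pdivrMr ?exprn_gt0// mulrAC; apply: (@cond u1).
by have := u1_ge0; have := u2_ge0; rewrite /c1; lra.
Qed.

Let cond2 : 32 * 32 * Q <= N * b1 ^+ 2.
Proof.
rewrite -ler_pdivrMr ?exprn_gt0// mulrAC; apply: (@cond u2).
by have := u1_ge0; have := u2_ge0; rewrite /c1; lra.
Qed.

Let cond3 : Q <= N.
Proof. by rewrite -[leLHS]mul1r; exact: cond. Qed.

Let L_le_L3 : L <= L ^+ 3.
Proof. by rewrite exprS ler_peMr ?exprn_ege1// ltW. Qed.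

Lemma rate_small_L : L <= N.
Proof.
apply: le_trans cond3; apply: le_trans L_le_L3 _; rewrite /Q.
by rewrite ler_peMl ?exprn_ege1// exprn_ge0// ltW.
Qed.

Lemma rate_small_moment : 32 * L * (B ^+ 2 * b2 ^+ 2) <= N * b1 ^+ 4.
Proof.
apply: le_trans cond1; rewrite /Q.
have -> : 32 * L * (B ^+ 2 * b2 ^+ 2) = 32 * b2 ^+ 2 * (B ^+ 2 * L) by ring.
apply: ler_wpM2l; first by rewrite mulr_ge0// sqr_ge0.
by apply: ler_wpM2l; [exact: sqr_ge0|exact: L_le_L3].
Qed.

Let d : R := 2 * (4 * Num.sqrt L * (68 * B * Num.sqrt (L / N))).

(** The window [d] is twice the displacement caused by centring.  The constant is
[32 * (544 + 4) * 2 * 2]: 544 from [d], 4 from the entries, one factor 2 from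
[b1 / 2], and one from [sqrt (2 * L) <= 2 * sqrt L]. *)
Lemma anti_concentration_rate :
  32 * (d + 2 * (B * (2 * L) / Num.sqrt N)) / (b1 / 2) * Num.sqrt (2 * L) +
  p%:R * expR (- (N * (b1 / 2) ^+ 2 / (32 * (B * (2 * L)) ^+ 2))) <=
  16 * 32 * 137 / b1 * rate + expR (- L).
Proof.
have sN : 0 < Num.sqrt N by rewrite sqrtr_gt0.
have sL : 0 <= Num.sqrt L by exact: sqrtr_ge0.
apply: lerD.
  have dE : d = 16 * 34 * (B * L / Num.sqrt N).
    rewrite /d sqrtrM ?ltW// sqrtrV ?ltW//.
    have -> : 2 * (4 * Num.sqrt L * (68 * B * (Num.sqrt L * (Num.sqrt N)^-1))) =
      16 * 34 * (B * (Num.sqrt L ^+ 2) / Num.sqrt N) by ring.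
    by rewrite sqr_sqrtr// ltW.
  have s2 : Num.sqrt (2 * L) <= 2 * Num.sqrt L.
    rewrite sqrtrM// ler_wpM2r// -[leRHS]ger0_norm// -sqrtr_sqr ler_wsqrtr//; lra.
  rewrite dE rateE.
  have -> : 32 * (16 * 34 * (B * L / Num.sqrt N) + 2 * (B * (2 * L) / Num.sqrt N)) / (b1 / 2)
    = 16 * 16 * 137 / b1 * (B * L / Num.sqrt N) by field; rewrite !gt_eqF.
  have -> : 16 * 32 * 137 / b1 * (B * L * Num.sqrt L / Num.sqrt N) =
    16 * 16 * 137 / b1 * (B * L / Num.sqrt N) * (2 * Num.sqrt L) by field; rewrite !gt_eqF.
  by rewrite ler_wpM2l// !mulr_ge0// ?invr_ge0 ?ltW.
have -> : expR (- L) = p%:R * n%:R * expR (- (2 * L)).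
  by rewrite -natrM -expL -expRD; congr expR; lra.
rewrite -[leRHS]mulrA ler_wpM2l//; apply: (@le_trans _ _ (expR (- (2 * L)))); last first.
  by rewrite ler_peMl ?expR_ge0.
rewrite ler_expR lerN2.
have -> : N * (b1 / 2) ^+ 2 / (32 * (B * (2 * L)) ^+ 2) =
  N * b1 ^+ 2 / (16 * 32 * B ^+ 2 * L ^+ 2) by field; rewrite !gt_eqF.
rewrite ler_pdivlMr ?mulr_gt0 ?exprn_gt0//.
apply: le_trans cond2; rewrite /Q; lra.
Qed.

Lemma total_error_rate :
  2 * expR (- (2 * L)) + (16 * 32 * 137 / b1 * rate + expR (- L)) + 5 * expR (- L) <=
  (16 * 32 * 137 / b1 + 8 + c1) * rate.
Proof.
have h1 : expR (- (2 * L)) <= expR (- L) by rewrite ler_expR; have := L0; lra.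
have h2 : expR (- L) <= rate by exact: expNL_le_rate.
have h3 : 0 <= c1 * rate by rewrite mulr_ge0// (le_trans _ c1_ge1).
rewrite [leRHS]mulrDl [X in _ <= X + _]mulrDl.
have sum_le (x y r u v : R) : x <= y -> y <= r -> 0 <= v ->
    2 * x + (u + y) + 5 * y <= u + 8 * r + v by lra.
exact: sum_le.
Qed.

End small.
End Rate.

Theorem theorem2p3 (R : realType) (b1 b2 : R) (hb1 : 0 < b1) (hb12 : b1 <= b2) :
  exists C : R,
  forall (n p : nat) (B : R) (a : p.-tuple R) (alpha : R)
    (d : measure_display) (T : measurableType d) (P : probability T R)
    (X : 'I_n -> {RV P >-> p.-tuple R}) (e : 'I_n -> {RV P >-> R})
    (k : R.-pker (n.-tuple (p.-tuple R)) ~> R),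
  (3 <= n)%N -> (2 <= p)%N -> 1 <= B -> 0 < alpha -> alpha < 1 ->
  mutually_independent P (fun i => X i : T -> p.-tuple R) ->
  (forall i j, ('E_P[fun w => tnth (X i w) j] = 0)%E) ->
  (* Condition E *)
  (forall i j, ('E_P[fun w => expR (`|tnth (X i w) j| / B)] <= 2%:E)%E) ->
  (* Condition M *)
  (forall j,
    ((b1 ^+ 2)%:E <=
       n%:R^-1%:E * \sum_(i < n) 'E_P[fun w => (tnth (X i w) j ^+ 2)%R])%E /\
    (n%:R^-1%:E * \sum_(i < n) 'E_P[fun w => (tnth (X i w) j ^+ 4)%R] <=
       (B ^+ 2 * b2 ^+ 2)%:E)%E) ->
  (* Condition S *)
  (forall i, identically_distributed P (X i) (fun w => oppt (X i w))) ->
  (* Rademacher weights, independent of the data *)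
  mutually_independent P (fun i => e i : T -> R) ->
  (forall i, rademacher P (e i)) ->
  independent2 P (joint e) (joint X) ->
  let Tn := fun w => max_stat a (joint X w) in
  let Tstar :=
    fun w => max_stat a (multiplier_sample (joint e w) (joint X w)) in
  let cB := fun w => quantile (k (joint X w)) (1 - alpha) in
  conditional_distribution P Tstar (joint X) k ->
  (`|P [set w | (cB w < Tn w)%R] - alpha%:E| <=
     (C * Num.sqrt (B ^+ 2 * ln (p * n)%:R ^+ 3 / n%:R))%:E)%E.
Proof.
have hb2 : 0 < b2 by exact: lt_le_trans hb12.
pose c1 : R := 32 * b2 ^+ 2 / b1 ^+ 4 + 32 * 32 / b1 ^+ 2 + 1.
exists (16 * 32 * 137 / b1 + 8 + c1).
move=> n p B a alpha d T P X e k n3 p2 B1 alpha0 alpha1 indX EX EexpX momX symX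
  inde rade indeX Tn Tstar cB condk.
have n0 : (0 < n)%N by rewrite (leq_trans _ n3).
have p0 : (0 < p)%N by rewrite (leq_trans _ p2).
have mX i : measurable_fun setT (X i) by exact: measurable_funP.
have me i : measurable_fun setT (e i) by exact: measurable_funP.
have g0 : 0 < 1 - alpha by lra.
have g1 : 1 - alpha < 1 by lra.
rewrite (probability_quantile_lt p0 mX me inde rade indeX condk g0 g1).
set L := ln (p * n)%:R; set rate := Num.sqrt _.
have rate0 : 0 <= rate by exact: sqrtr_ge0.
have B0 : 0 < B by exact: lt_le_trans B1.
have L1 : 1 <= L by exact: ln_natM_ge1.
have L0 : 0 < L by exact: lt_le_trans L1.
(* If the rate is large, any probability is within the bound. *)
have [big|small] := ltP n%:R (c1 * (B ^+ 2 * L ^+ 3)).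
  have h1 := one_le_rate n3 p2 B1 hb1 hb2 big.
  have mE : measurable (joint X @^-1` exceed a (1 - alpha)).
    by rewrite -[X in measurable X]setTI; apply: measurable_joint => //; exact: measurable_exceed.
  pose z := fine (P (joint X @^-1` exceed a (1 - alpha))).
  have PE : P (joint X @^-1` exceed a (1 - alpha)) = z%:E.
    by rewrite fineK// fin_num_measure.
  have z0 : 0 <= z by rewrite fine_ge0.
  have z1 : z <= 1 by rewrite -lee_fin -PE; exact: probability_le1.
  rewrite PE -EFinB /= lee_fin; clearbody z.
  apply: (@le_trans _ _ 1); first by rewrite ler_norml; apply/andP; split; lra.
  have A0 : 0 <= 16 * 32 * 137 / b1 by rewrite divr_ge0 ?ltW.
  by apply: (le_trans h1); rewrite ler_wpM2r// lerDr addr_ge0.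
have expL : expR L = (p * n)%:R by rewrite lnK// posrE ltr0n muln_gt0 p0.
pose K := B * (2 * L); pose r := 68 * B * Num.sqrt (L / n%:R).
have K0 : 0 < K by rewrite !mulr_gt0.
have nR0 : (0 : R) < n%:R by rewrite ltr0n.
have r0 : 0 < r by rewrite !mulr_gt0// sqrtr_gt0 divr_gt0.
pose rho := 16 * 32 * 137 / b1 * rate + expR (- L).
have rho0 : 0 <= rho by rewrite addr_ge0 ?expR_ge0// mulr_ge0// divr_ge0// ltW.
have pL : 2 * p%:R <= expR (2 * L).
  have -> : 2 * L = L + L by lra.
  rewrite expRD expL -!natrM ler_nat.
  rewrite (leq_trans (leq_mul (leqnn 2) (leq_pmulr p n0)))//.
  by rewrite leq_mul// (leq_trans p2)// leq_pmulr.
have rhoP x : regular K (b1 / 2) x -> forall t, cube_prob [pred c |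
     t <= max_stat a (@sign_flip R n p c x) <= t + 2 * (4 * Num.sqrt L * r)] <= rho.
  move=> rx t.
  have b120 : 0 < b1 / 2 by rewrite divr_gt0.
  have d0 : 0 <= 2 * (4 * Num.sqrt L * r) by rewrite !mulr_ge0 ?sqrtr_ge0// ltW.
  have L21 : 1 <= 2 * L by lra.
  apply: (le_trans (regular_anti_concentration a n0 p0 t K0 b120 d0 L21 pL rx)).
  exact: (anti_concentration_rate n3 p2 B1 hb1 hb2 small).
have badP := irregular_probability mX indX n0 p0 hb1 hb2 B0 L0 expL
  (rate_small_L n3 p2 B1 hb1 hb2 small) (rate_small_moment n3 p2 B1 hb1 hb2 small) EX EexpX momX.
have := randomization_error n0 p0 mX indX symX L0 r0 g0 g1 rho0 rhoP badP.
rewrite subKr => err; apply: (le_trans err); rewrite lee_fin.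
exact: (total_error_rate n3 p2 B1 hb1 hb2).
Qed.
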